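(* Let $p\in\mathbb{C}[x]$ be a non-zero polynomial of degree $n$ and let $c\in\mathbb{C}$ be such that $p(x)=(-1)^np(-x+c)$. Consider either choice of sign $\pm$, and let $\lambda\in\big((\widehat{\mathcal{D}}_p^{\pm})_0\big)^*$. The irreducible highest weight module $L(\widehat{\mathcal{D}}_p^{\pm},\lambda)$ is quasifinite if and only if $$\Delta_{\lambda}(x)=p\left(\frac{d}{dx}+\frac{c}{2}\right)\left(\frac{\phi_{\lambda}(x)}{2\sinh\left(\frac{x}{2}\right)}\right)$$ for some even quasipolynomial $\phi_{\lambda}(x)$ such that $\phi_{\lambda}(0)=0$.
   Context: Let $\mathcal{D}^a$ be the associative algebra with basis $t^kD^l$ ($k\in\mathbb{Z}$, $l\in\mathbb{Z}_{\ge 0}$), $D=t\frac{d}{dt}$, and product $t^rf(D)\,t^sg(D)=t^{r+s}f(D+s)g(D)$; let $\mathcal{D}$ be the same space with the commutator bracket, and $\mathcal{D}_p=\mathcal{D}^ap(D)$, viewed as a Lie algebra. The maps $\sigma_{\pm}\big(t^kf(D)p(D)\big)=(-1)^n(\pm1)^kt^kf(-D-k+c)p(D)$ are anti-involutions of the associative algebra $\mathcal{D}^ap(D)$, and $\mathcal{D}_p^{\pm}=\{d\in\mathcal{D}_p:\sigma_\pm(d)=-d\}$ is a Lie subalgebra. On $\mathcal{D}$ there is the 2-cocycle $\Psi$ (antisymmetric) with $\Psi(t^rf(D),t^sg(D))=\sum_{-r\le m\le -1}f(m)g(m+r)$ if $r=-s>0$, and $0$ if $r+s\ne0$ or $r=s=0$.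 $\widehat{\mathcal{D}}_p^{\pm}=\mathcal{D}_p^{\pm}\oplus\mathbb{C}C$ is the central extension of $\mathcal{D}_p^\pm$ defined by the restriction of $\Psi$. It is $\mathbb{Z}$-graded (principal gradation) by $\mathrm{wt}\,t^kf(D)p(D)=k$, $\mathrm{wt}\,C=0$. Set $\bar n=1$ if $n$ is even and $\bar n=0$ if $n$ is odd. The degree zero part $(\widehat{\mathcal{D}}_p^{\pm})_0$ is commutative, with basis $C$ and $(D-\frac c2)^lp(D)$, where $l$ ranges over the non-negative integers with $l\equiv\bar n \pmod 2$. For a $\mathbb{Z}$-graded Lie algebra $\mathfrak g=\bigoplus\mathfrak g_j$ with $\mathfrak g_0$ commutative and $\lambda\in\mathfrak g_0^*$, $L(\mathfrak g,\lambda)$ denotes the irreducible $\mathbb{Z}$-graded module generated by a vector $v_\lambda$ of degree $0$ with $hv_\lambda=\lambda(h)v_\lambda$ for $h\in\mathfrak g_0$ and $\mathfrak g_jv_\lambda=0$ for $j>0$ (the quotient of the Verma module by its maximal proper graded submodule). A $\mathbb{Z}$-graded module $V=\bigoplus V_j$ is quasifinite if $\dim V_j<\infty$ for all $j$. The labels of $\lambda$ are $\triangle_l=-\lambda\big((D-\frac c2)^lp(D)\big)$, and $\Delta_\lambda(x)=\sum_{l}\frac{x^l}{l!}\triangle_l\in\mathbb{C}[[x]]$, the sum being over non-negative integers $l\equiv\bar n\pmod 2$. A quasipolynomial is a finite linear combination of functions $q(x)e^{\alpha x}$ with $q\in\mathbb{C}[x]$, $\alpha\in\mathbb{C}$ (regarded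 as a formal power series in $x$). *)

(* Defs.v *)
From HB Require Import structures.
From mathcomp Require Import all_boot all_order all_algebra.
From mathcomp Require Import boolp classical_sets.
From mathcomp Require Import finmap monalg.

Set Implicit Arguments.
Unset Strict Implicit.
Unset Printing Implicit Defensive.

Import GRing.Theory.
Local Open Scope classical_set_scope.
Local Open Scope ring_scope.

(* Graded modules.  A Lie algebra is given as a subspace L of an ambient vector
   space G carrying a bracket br, with homogeneous components Lg j.  Maps out
   of L (an action, a functional) are total on G; only their restriction to L
   is ever constrained or used. *)
Section GradedModules.
Variable K : fieldType.

Definition is_subspace (V : lmodType K) (W : set V) : Prop :=
  W 0 /\ forall (a : K) (u v : V), W u -> W v -> W (a *: u + v).

Definition sum_of_components (V : lmodType K) (Vg : int -> set V) : set V :=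
  [set v | exists (s : seq int) (f : int -> V),
     (forall j, Vg j (f j)) /\ v = \sum_(j <- s) f j].

Definition is_grading (V : lmodType K) (Vg : int -> set V) : Prop :=
  [/\ forall j, is_subspace (Vg j),
      forall v, sum_of_components Vg v
    & forall (s : seq int) (f : int -> V), uniq s ->
        (forall j, Vg j (f j)) -> \sum_(j <- s) f j = 0 ->
        forall j, j \in s -> f j = 0].

Definition finite_dim (V : lmodType K) (W : set V) : Prop :=
  exists (n : nat) (e : 'I_n -> V),
    forall v, W v -> exists a : 'I_n -> K, v = \sum_(i < n) a i *: e i.

Definition quasifinite (V : lmodType K) (Vg : int -> set V) : Prop :=
  forall j, finite_dim (Vg j).

Variables (G : lmodType K) (br : G -> G -> G) (L : set G) (Lg : int -> set G).

Definition linear_on (W : set G) (lam : G -> K) : Prop :=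
  forall (a : K) (x y : G), W x -> W y -> lam (a *: x + y) = a * lam x + lam y.

Section Module.
Variables (V : lmodType K) (act : G -> V -> V) (Vg : int -> set V).

Record is_graded_module : Prop := IsGradedModule {
  gmod_grading : is_grading Vg;
  gmod_linear : forall x, L x -> linear (act x);
  gmod_linearl : forall (a : K) x y v, L x -> L y ->
    act (a *: x + y) v = a *: act x v + act y v;
  gmod_bracket : forall x y v, L x -> L y ->
    act (br x y) v = act x (act y v) - act y (act x v);
  gmod_degree : forall i j x v, Lg i x -> Vg j v -> Vg (i + j) (act x v)
}.

Definition is_submodule (W : set V) : Prop :=
  is_subspace W /\ forall x v, L x -> W v -> W (act x v).

Definition is_graded_subset (W : set V) : Prop :=
  W `<=` sum_of_components (fun j => Vg j `&` W).

Definition graded_irreducible : Prop :=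
  (exists v : V, v != 0) /\
  forall W : set V, is_submodule W -> is_graded_subset W ->
    W = [set 0] \/ W = setT.

(* V, with its action and grading, is the quotient of the Verma module of
   highest weight lam by its maximal proper graded submodule: these conditions
   determine it up to isomorphism of graded modules.  Irreducibility refers to
   graded submodules only. *)
Record is_irr_highest_weight_module (lam : G -> K) : Prop :=
  IsIrrHighestWeightModule {
  hw_module : is_graded_module;
  hw_irreducible : graded_irreducible;
  hw_vector : exists v : V,
    [/\ v != 0, Vg 0 v,
        forall h, Lg 0 h -> act h v = lam h *: v,
        forall (j : int) x, (0 < j)%R -> Lg j x -> act x v = 0
      & forall W : set V, is_submodule W -> W v -> W = setT]
}.

End Module.
End GradedModules.

(* D^a: the coefficient of a : diffop K at k is the polynomial f such that
   t^k f(D) is the degree k part of a; << f *g k >> is t^k f(D). *)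
Definition diffop (K : fieldType) := {malg {poly K}[int]}.

Section DiffopModule.
Variable K : fieldType.

HB.instance Definition _ := GRing.Zmodule.on (diffop K).

Let scale (a : K) (d : diffop K) : diffop K := a%:P *: (d : {malg {poly K}[int]}).

Fact diffop_scaleA a b d : scale a (scale b d) = scale (a * b) d.
Proof. by rewrite /scale scalerA -polyCM. Qed.
Fact diffop_scale1 : left_id 1 scale.
Proof. by move=> d; rewrite /scale polyC1 scale1r. Qed.
Fact diffop_scaleDr : right_distributive scale +%R.
Proof. by move=> a d e; rewrite /scale scalerDr. Qed.
Fact diffop_scaleDl d : {morph scale^~ d : a b / a + b}.
Proof. by move=> a b; rewrite /scale polyCD scalerDl. Qed.

HB.instance Definition _ := GRing.Zmodule_isLmodule.Build K (diffop K)
  diffop_scaleA diffop_scale1 diffop_scaleDr diffop_scaleDl.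
End DiffopModule.

Section Dp.
Variable K : fieldType.
Implicit Types (a b d e : diffop K) (f g p : {poly K}) (c : K) (k : int).

Definition dterm k f : diffop K := << f *g k >>.

(* t^r f(D) t^s g(D) = t^(r+s) f(D+s) g(D) *)
Definition dmul a b : diffop K :=
  \sum_(r <- msupp a) \sum_(s <- msupp b)
    dterm (r + s) ((a@_r \Po ('X + (s%:~R)%:P)) * b@_s).

Definition cocycle_term k f g : K :=
  match k with
  | Posz r => \sum_(1 <= m < r.+1) f.[- m%:R] * g.[- m%:R + r%:R]
  | Negz r => - \sum_(1 <= m < r.+2) g.[- m%:R] * f.[- m%:R + r.+1%:R]
  end.

Definition cocycle a b : K :=
  \sum_(k <- msupp a) cocycle_term k a@_k b@_(- k).

(* The second component is the coefficient of the central element C. *)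
Definition dhat := (diffop K * K^o)%type.

Definition dhat_bracket (x y : dhat) : dhat :=
  (dmul x.1 y.1 - dmul y.1 x.1, cocycle x.1 y.1).

(* The degree of p, for p != 0. *)
Definition deg p : nat := (size p).-1.

(* The image of e p(D) under the anti-involution sigma_+ (if ~~ sgn) or
   sigma_- (if sgn). *)
Definition sigma (sgn : bool) p c e : diffop K :=
  \sum_(k <- msupp e)
    dterm k (((-1) ^+ deg p * ((-1) ^+ sgn) ^ k) *:
             ((e@_k \Po (- 'X - (k%:~R)%:P + c%:P)) * p)).

Definition Dp_pm (sgn : bool) p c : set (diffop K) :=
  [set d | exists2 e, d = dmul e (dterm 0 p) & sigma sgn p c e = - d].

Definition dhat_pm (sgn : bool) p c : set dhat := [set x | Dp_pm sgn p c x.1].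

Definition dhat_pm_deg (sgn : bool) p c (k : int) : set dhat :=
  [set x | [/\ Dp_pm sgn p c x.1, exists f, x.1 = dterm k f
             & k != 0 -> x.2 = 0]].

End Dp.

(* Formal power series, as sequences of coefficients. *)
Section Fps.
Variable K : fieldType.
Local Notation fps := (nat -> K).
Implicit Types (u v phi psi : fps).

Definition fps_mul u v : fps := fun k => \sum_(i < k.+1) u i * v (k - i)%N.

Definition fps_deriv u : fps := fun k => k.+1%:R * u k.+1.

(* e^(a x) *)
Definition fps_exp (a : K) : fps := fun k => a ^+ k / k`!%:R.

Definition fps_of_poly (q : {poly K}) : fps := fun k => q`_k.

(* 2 sinh(x / 2) *)
Definition fps_2sinh_half : fps :=
  fun k => fps_exp (1 / 2%:R) k - fps_exp (- (1 / 2%:R)) k.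

(* u / v: the power series w with v w = u.  It is unique if v != 0; if there
   is none, the value is the zero series. *)
Definition fps_div u v : fps :=
  xget (fun=> 0) [set w : fps | fps_mul v w = u].

(* p(d/dx + a) u *)
Definition fps_diffop (p : {poly K}) (a : K) u : fps :=
  fun k => \sum_(i < size p)
    p`_i * iter i (fun w : fps => fun j => fps_deriv w j + a * w j) u k.

Definition quasipolynomial phi : Prop :=
  exists s : seq ({poly K} * K),
    forall k, phi k = \sum_(q <- s) fps_mul (fps_of_poly q.1) (fps_exp q.2) k.

Definition fps_even phi : Prop := forall k, (-1) ^+ k * phi k = phi k.

Definition label (p : {poly K}) (c : K) (lam : dhat K -> K) (l : nat) : K :=
  - lam (dterm 0 (('X - (c / 2%:R)%:P) ^+ l * p), 0).

Definition label_series (p : {poly K}) (c : K) (lam : dhat K -> K) : fps :=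
  fun l => if odd l == ~~ odd (deg p) then label p c lam l / l`!%:R else 0.

End Fps.

(* Main.v *)
Require Import Defs.
From HB Require Import structures.
From mathcomp Require Import all_boot all_order all_algebra ring zify.
From mathcomp Require Import boolp classical_sets reals complex.
From mathcomp Require Import finmap monalg.
Import Order.TTheory GRing.Theory Num.Theory.
Local Open Scope classical_set_scope.
Local Open Scope ring_scope.
Set Implicit Arguments.
Unset Strict Implicit.
Unset Printing Implicit Defensive.

(* Write P(y) = p(y + c/2), which has the parity of n, and let t^k u(D - (c - k)/2) p(D)
   stand for the polynomial u; membership in the Lie algebra then means that u has
   a parity depending only on k and the sign.  A power series F is identified with
   the functional q |-> (q(d/dx) F)(0) on polynomials: multiplication by e^(ax)
   becomes the shift q(y) |-> q(y + a), the operator p(d/dx + c/2) becomes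
   multiplication by P, and quasipolynomials are the functionals that vanish on
   the multiples of some nonzero polynomial.

   If V_(-1) is finite dimensional, some nonzero h in degree -1 kills v.  Applying
   degree 1 elements divisible by suitable polynomials (to suppress the cocycle)
   shows that Delta vanishes on (r e)(y - 1/2) P(y - 1) for a fixed even r <> 0 and
   all even e.  With Delta = P(d/dx) Theta and Theta odd, this says that
   phi = 2 sinh(x/2) Theta vanishes on multiples of r P(y - 1/2) P(y + 1/2), so phi
   is a quasipolynomial.

   Conversely, 2 sinh(kx/2) is a multiple of 2 sinh(x/2) by an exponential
   polynomial, so for every k > 0 there is g_k <> 0 such that lam vanishes on all brackets
   of degree k elements with multiples of g_k in degree -k.  The polynomials in
   degree -k all of whose relevant shifts are divisible by g_1, ..., g_k generate a
   proper graded submodule when applied to v, hence kill v.  So in every negative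
   degree v, and by induction every vector, is killed by all multiples of some nonzero
   polynomial, and the graded components are finite dimensional. *)

(** * Power series as functionals on polynomials *)

Section ShiftReflection.
Variable F : fieldType.
Implicit Types (q r : {poly F}) (a b : F).

Definition shift a := comp_poly ('X + a%:P).
Definition reflect_poly : {poly F} -> {poly F} := comp_poly (- 'X).

HB.instance Definition _ a := GRing.LRMorphism.on (shift a).
HB.instance Definition _ := GRing.LRMorphism.on reflect_poly.

Lemma shift_shift a b q : shift a (shift b q) = shift (a + b) q.
Proof.
rewrite /shift -comp_polyA comp_polyD comp_polyX comp_polyC.
by rewrite -addrA -polyCD.
Qed.

Lemma shift0 q : shift 0 q = q.
Proof. by rewrite /shift addr0 comp_polyXr. Qed.

Lemma shiftK a : cancel (shift a) (shift (- a)).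
Proof. by move=> q; rewrite shift_shift addNr shift0. Qed.

Lemma reflectK : involutive reflect_poly.
Proof.
move=> q; rewrite /reflect_poly -comp_polyA raddfN /= comp_polyX opprK.
exact: comp_polyXr.
Qed.

Lemma reflect_shift a q :
  reflect_poly (shift a q) = shift (- a) (reflect_poly q).
Proof.
rewrite /shift /reflect_poly -!comp_polyA; congr (_ \Po _).
by rewrite comp_polyD raddfN /= !comp_polyX comp_polyC opprD polyCN opprK.
Qed.

Lemma shift_eq0 a q : (shift a q == 0) = (q == 0).
Proof.
apply/eqP/eqP => [|->]; last by rewrite rmorph0.
by move/(congr1 (shift (- a))); rewrite shiftK rmorph0.
Qed.

Lemma reflect_eq0 q : (reflect_poly q == 0) = (q == 0).
Proof. by rewrite -(inj_eq (inv_inj reflectK)) reflectK rmorph0. Qed.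

Lemma dvdp_shift a q r : q %| r -> shift a q %| shift a r.
Proof. by move=> /dvdpP[s ->]; rewrite rmorphM dvdp_mull. Qed.

Lemma horner_shift a q b : (shift a q).[b] = q.[b + a].
Proof. by rewrite horner_comp !hornerE. Qed.

Lemma shiftX a : shift a 'X = 'X + a%:P.
Proof. by rewrite /shift comp_polyX. Qed.

Lemma reflectX : reflect_poly 'X = - 'X.
Proof. by rewrite /reflect_poly comp_polyX. Qed.

Lemma coef_reflect q i : (reflect_poly q)`_i = (-1) ^+ i * q`_i.
Proof.
rewrite /reflect_poly -[q in q \Po _]coefK poly_def raddf_sum /= coef_sum.
under eq_bigr => j _.
  rewrite linearZ /= rmorphXn /= comp_polyX -scaleN1r exprZn !coefZ coefXn; over.
case: (ltnP i (size q)) => [ltiq|leqi].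
  rewrite (bigD1 (Ordinal ltiq)) //= eqxx mulr1 big1 ?addr0 1?mulrC // => j.
  by rewrite -val_eqE /= eq_sym => /negPf->; rewrite !mulr0.
rewrite nth_default // mulr0 big1 // => j _.
by rewrite gtn_eqF ?mulr0 // (leq_trans _ leqi).
Qed.

End ShiftReflection.

Section Pairing.
Variable K : numFieldType.
Implicit Types (u v w : nat -> K) (q r : {poly K}) (a : K).

(* The constant term of q(d/dx) u(x). *)
Definition pairing u q := \sum_(i < size q) q`_i * (i`!%:R * u i).

Lemma pairing_widen n u q : (size q <= n)%N ->
  pairing u q = \sum_(i < n) q`_i * (i`!%:R * u i).
Proof.
move=> le_qn; rewrite /pairing.
rewrite (big_ord_widen n (fun i => q`_i * (i`!%:R * u i)) le_qn) big_mkcond.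
by apply: eq_bigr => i _; case: ltnP => // le; rewrite nth_default ?mul0r.
Qed.

Fact pairing_is_linear u : scalar (pairing u).
Proof.
move=> a q r; pose n := maxn (size (a *: q + r)) (maxn (size q) (size r)).
rewrite !(@pairing_widen n) ?leq_max ?leqnn ?orbT //.
rewrite mulr_sumr -big_split /=; apply: eq_bigr => i _.
by rewrite coefD coefZ mulrDl mulrA.
Qed.

HB.instance Definition _ u :=
  GRing.isLinear.Build K {poly K} K _ (pairing u) (pairing_is_linear u).

Lemma pairingXn u n : pairing u 'X^n = n`!%:R * u n.
Proof.
rewrite /pairing size_polyXn big_ord_recr /= coefXn eqxx mul1r big1 ?add0r //.
by move=> i _; rewrite coefXn ltn_eqF ?mul0r.
Qed.

Lemma fact_neq0 n : n`!%:R != 0 :> K.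
Proof. by rewrite pnatr_eq0 -lt0n fact_gt0. Qed.

Lemma poly_functional_ext (f g : {poly K} -> K) : scalar f -> scalar g ->
  (forall n, f 'X^n = g 'X^n) -> f =1 g.
Proof.
move=> lf lg fgX q.
pose f' : {scalar {poly K}} := HB.pack f (GRing.isLinear.Build K {poly K} K _ f lf).
pose g' : {scalar {poly K}} := HB.pack g (GRing.isLinear.Build K {poly K} K _ g lg).
change (f' q = g' q); rewrite -[q]coefK poly_def !linear_sum.
by apply: eq_bigr => i _; rewrite !linearZ /=; congr (_ * _); apply: fgX.
Qed.

Lemma pairing_inj u v : pairing u =1 pairing v -> u = v.
Proof.
move=> uv; apply/funext => n; have := uv 'X^n; rewrite !pairingXn.
exact/mulfI/fact_neq0.
Qed.

Definition fps_of_functional (f : {poly K} -> K) : nat -> K :=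
  fun n => f 'X^n / n`!%:R.

Lemma pairing_of_functional (f : {poly K} -> K) : scalar f ->
  pairing (fps_of_functional f) =1 f.
Proof.
move=> lf; apply: poly_functional_ext => //; first exact: pairing_is_linear.
by move=> n; rewrite pairingXn mulrC divfK ?fact_neq0.
Qed.

Lemma fps_mulC u v : fps_mul u v = fps_mul v u.
Proof.
apply/funext => n; rewrite /fps_mul (reindex_inj rev_ord_inj) /=.
apply: eq_bigr => i _; rewrite mulrC subSS subKn //; exact: leq_ord.
Qed.

(** Moving d/dx past e^(ax) turns it into d/dx + a; on monomials this is the binomial theorem. *)
Lemma pairing_mul_exp a u q :
  pairing (fps_mul (fps_exp a) u) q = pairing u (shift a q).
Proof.
apply: (poly_functional_ext (f := pairing _) (g := pairing u \o shift a)).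
- exact: pairing_is_linear.
- by move=> b s t; rewrite /= !linearP.
move=> n /=; rewrite pairingXn rmorphXn /= shiftX exprDn linear_sum /=.
rewrite mulr_sumr; apply: eq_bigr => -[i /= le_in] _; rewrite ltnS in le_in.
rewrite -polyC_exp [X in pairing u (X *+ _)]mulrC mul_polyC -scaler_nat !linearZ /= pairingXn.
by rewrite /fps_exp -(bin_fact le_in) !natrM; field; apply: fact_neq0.
Qed.

Lemma pairing_mul_2sinh u q :
  pairing (fps_mul (fps_2sinh_half K) u) q =
  pairing u (shift (2^-1) q - shift (- 2^-1) q).
Proof.
rewrite linearB /= -!pairing_mul_exp /pairing -sumrB; apply: eq_bigr => i _.
rewrite -!mulrBr /fps_mul -sumrB; do 2!congr (_ * _).
by apply: eq_bigr => j _; rewrite -mulrBl /fps_2sinh_half !div1r.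
Qed.

(** Differentiating the series is dual to multiplying the polynomial by ['X], so d/dx + a is dual to
    multiplication by ['X + a%:P]. *)
Lemma pairing_diffop r a u q :
  pairing (fps_diffop r a u) q = pairing u (q * shift a r).
Proof.
pose d w : nat -> K := fun j => fps_deriv w j + a * w j.
have pd w s : pairing (d w) s = pairing w (s * ('X + a%:P)).
  apply: (poly_functional_ext (f := pairing _)
           (g := fun s => pairing w (s * ('X + a%:P)))).
  - exact: pairing_is_linear.
  - by move=> b s1 s2; rewrite mulrDl -scalerAl linearP.
  move=> n; rewrite pairingXn [X in pairing w X]mulrDr -exprSr linearD /=.
  rewrite pairingXn [_ * a%:P]mulrC mul_polyC linearZ /= pairingXn /d /fps_deriv.
  by rewrite factS natrM; ring.
have pit i w s : pairing (iter i d w) s = pairing w (s * ('X + a%:P) ^+ i).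
  elim: i s => [|i IHi] s /=; first by rewrite mulr1.
  by rewrite pd IHi exprS mulrA.
rewrite /shift comp_polyE mulr_sumr linear_sum /=.
transitivity (\sum_(i < size r) r`_i * pairing (iter i d u) q).
  rewrite /pairing; under [RHS]eq_bigr => i _ do rewrite mulr_sumr.
  rewrite exchange_big /=; apply: eq_bigr => j _.
  rewrite /fps_diffop !mulr_sumr; apply: eq_bigr => i _.
  by ring.
by apply: eq_bigr => i _; rewrite pit -scalerAr linearZ.
Qed.

End Pairing.

(** * Quasipolynomials and linear equations with constant coefficients *)

Section Quasipolynomial.
Variable K : numClosedFieldType.
Implicit Types (u v w : nat -> K) (q r : {poly K}) (a : K).

(** All Taylor coefficients of r(d/dx) u vanish, that is, [u] solves r(d/dx) u = 0. *)
Definition annihilates r u := forall q, pairing u (r * q) = 0.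

Lemma annihilates_fps_of_poly q : annihilates 'X^(size q) (fps_of_poly q).
Proof.
move=> s; rewrite /pairing big1 // => i _; rewrite coefXnM.
case: ltnP => [_|le_qi]; first by rewrite mul0r.
by rewrite /fps_of_poly [q`__]nth_default ?mulr0.
Qed.

Lemma annihilates_exp_mul q a r u :
  annihilates (shift a r) u -> annihilates r (fps_mul u (fps_exp a)).
Proof. by move=> ru s; rewrite fps_mulC pairing_mul_exp rmorphM /= ru. Qed.

(** A term q e^(ax) is annihilated by X - a to the power [size q]; the product over the terms serves
    for the sum. *)
Lemma annihilated_of_quasipolynomial u : quasipolynomial u ->
  exists2 r : {poly K}, r != 0 & annihilates r u.
Proof.
case=> s; elim: s u => [|[q a] s IHs] u us.
  exists 1; rewrite ?oner_eq0 // => t; rewrite mul1r /pairing big1 // => i _.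
  by rewrite us big_nil !mulr0.
have [r r0 ru] := IHs _ (fun=> erefl).
exists (('X - a%:P) ^+ size q * r).
  by rewrite mulf_neq0 // expf_neq0 // polyXsubC_eq0.
move=> t; set w := fun k : nat => \sum_(_ <- s) _ in ru.
have uE (v : {poly K}) : pairing u v = pairing (fps_mul (fps_of_poly q) (fps_exp a)) v + pairing w v.
  rewrite /pairing -big_split; apply: eq_bigr => i _ /=.
  by rewrite us big_cons !mulrDr.
rewrite uE -mulrA [X in _ + pairing _ X]mulrCA ru addr0 annihilates_exp_mul //.
by rewrite rmorphXn rmorphB /= shiftX /shift comp_polyC addrK; exact: annihilates_fps_of_poly.
Qed.

Lemma quasipolynomialD u v : quasipolynomial u -> quasipolynomial v ->
  quasipolynomial (u \+ v).
Proof.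
by move=> [s us] [t vt]; exists (s ++ t) => k; rewrite big_cat /= us vt.
Qed.

Lemma quasipolynomial0 : quasipolynomial (fun=> 0 : K).
Proof. by exists [::] => k; rewrite big_nil. Qed.

(** Multiplication by e^(-ax) moves the root to 0, and a series annihilated by ['X^m] has no terms
    of degree m or more. *)
Lemma quasipolynomial_of_pow_annihilated m a u :
  annihilates (('X - a%:P) ^+ m) u -> quasipolynomial u.
Proof.
move=> au; pose v := fps_mul (fps_exp (- a)) u.
have v0 i : (m <= i)%N -> v i = 0.
  move=> lemi; apply/eqP; rewrite -(mulrI_eq0 _ (lregP (fact_neq0 K i))).
  rewrite -pairingXn pairing_mul_exp -(subnKC lemi) exprD rmorphM /=.
  by rewrite rmorphXn /= shiftX polyCN au.
exists [:: (\poly_(i < m) v i, a)] => k; rewrite big_seq1 /=.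
move: k; apply/funeqP/pairing_inj => q; rewrite fps_mulC pairing_mul_exp.
have -> : fps_of_poly (\poly_(i < m) v i) = v.
  apply/funext => i; rewrite /fps_of_poly coef_poly.
  by case: ltnP => // /v0 ->.
by rewrite pairing_mul_exp shift_shift addNr shift0.
Qed.

Lemma quasipolynomial_of_annihilated r u :
  r != 0 -> annihilates r u -> quasipolynomial u.
Proof.
have [n] := ubnP (size r); elim: n r u => // n IHn r u; rewrite ltnS.
move=> le_rn r0 ru; have [/size_poly1P[c c0 rc]|] := boolP (size r == 1).
  have -> : u = (fun=> 0); last exact: quasipolynomial0.
  apply: pairing_inj => q; rewrite [RHS]big1 ?[RHS]/= => [|i _]; last by rewrite !mulr0.
  have := ru q; rewrite rc mul_polyC linearZ /= => /eqP.
  by rewrite mulf_eq0 (negPf c0) => /eqP.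
move=> /closed_rootP[a ra]; have [m [q]] := multiplicity_XsubC r a.
rewrite r0 /= => qa rE.
have m0 : (0 < m)%N.
  by case: m rE ra => // ->; rewrite expr0 mulr1 (negPf qa).
have cop : coprimep q (('X - a%:P) ^+ m).
  by apply: coprimep_expr; rewrite coprimep_XsubC.
have [[s t] /= st1] := Bezout_eq1_coprimepP _ _ cop.
have pD x y : pairing (fps_diffop x 0 u) y = pairing u (y * x).
  by rewrite pairing_diffop shift0.
(* The Bezout identity, read as one between differential operators, splits [u]: the first summand is
   annihilated by the power of X - a, the second by [q], of smaller degree. *)
have -> : u = fps_diffop (s * q) 0 u \+ fps_diffop (t * ('X - a%:P) ^+ m) 0 u.
  apply: pairing_inj => x.
  transitivity (pairing (fps_diffop (s * q) 0 u) x +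
                pairing (fps_diffop (t * ('X - a%:P) ^+ m) 0 u) x).
    by rewrite !pD -linearD -mulrDr st1 mulr1.
  by rewrite /pairing -big_split; apply: eq_bigr => i _; rewrite /= !mulrDr.
apply: quasipolynomialD.
  apply: (@quasipolynomial_of_pow_annihilated m a) => x; rewrite pD.
  by rewrite -[RHS](ru (s * x)) rE; congr pairing; ring.
have q0 : q != 0 by apply: contraNneq qa => ->; rewrite root0.
apply: (IHn q) => // [|x].
  rewrite (leq_trans _ le_rn) // rE size_Mmonic // ?monic_exp ?monicXsubC //.
  by rewrite size_exp_XsubC addnS /= -[X in (X < _)%N]addn0 ltn_add2l.
by rewrite pD -[RHS](ru (t * x)) rE; congr pairing; ring.
Qed.

End Quasipolynomial.

(** * The Lie algebra *)

Section Diffop.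
Variable K : fieldType.
Implicit Types (d e : diffop K) (f g : {poly K}) (k r s : int).

Lemma diffopD_coef d e k : (d + e)@_k = d@_k + e@_k.
Proof. exact: mcoeffD. Qed.

Lemma diffopZ_coef a d k : (a *: d)@_k = a *: d@_k.
Proof.
by rewrite -mul_polyC -[RHS]mcoeffZ.
Qed.

Lemma dterm_coef k f j : (dterm k f)@_j = if k == j then f else 0.
Proof. by rewrite /dterm mcoeffU; case: eqP. Qed.

Lemma dtermP k a f g : dterm k (a *: f + g) = a *: dterm k f + dterm k g.
Proof.
apply/malgP => j; rewrite diffopD_coef diffopZ_coef !dterm_coef.
by case: eqP; rewrite ?scaler0 ?addr0.
Qed.

Lemma dterm0 k : dterm k (0 : {poly K}) = 0.
Proof. exact: monalgU0. Qed.

Lemma diffop_coef0 k : (0 : diffop K)@_k = 0.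
Proof. exact: mcoeff0. Qed.

Lemma diffop_sum_coef (I : Type) (t : seq I) (F : I -> diffop K) k :
  (\sum_(i <- t) F i)@_k = \sum_(i <- t) (F i)@_k.
Proof. exact: (raddf_sum (mcoeff k)). Qed.

Lemma msupp_sum_coef d (F : int -> {poly K}) k :
  (d@_k = 0 -> F k = 0) ->
  (\sum_(j <- msupp d) dterm j (F j))@_k = F k.
Proof.
move=> F0; rewrite diffop_sum_coef; under eq_bigr do rewrite dterm_coef.
rewrite -big_mkcond /=; have [kd|kNd] := boolP (k \in msupp d); last first.
  rewrite F0 ?mcoeff_outdom // big_seq_cond big1 // => j /andP[jd /eqP jk].
  by rewrite -jk jd in kNd.
rewrite (big_rem k) //= eqxx big_seq_cond big1 ?addr0 // => j.
by rewrite mem_rem_uniq ?fset_uniq // inE => /andP[/andP[/negPf->]].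
Qed.

Lemma dmul_dterm r s f g :
  dmul (dterm r f) (dterm s g) = dterm (r + s) ((f \Po ('X + (s%:~R)%:P)) * g).
Proof.
rewrite /dmul /dterm !msuppU.
have [->|f0] := eqVneq f 0; first by rewrite big_nil comp_poly0 mul0r monalgU0.
have [->|g0] := eqVneq g 0; first by rewrite big_seq_fset1 big_nil mulr0 monalgU0.
by rewrite !big_seq_fset1 !mcoeffUU.
Qed.

Lemma dmul_dterm0_coef e p k : (dmul e (dterm 0 p))@_k = e@_k * p.
Proof.
rewrite /dmul /dterm msuppU; have [->|p0] := eqVneq p 0.
  by rewrite diffop_sum_coef big1 ?mulr0 // => r _; rewrite big_nil diffop_coef0.
under eq_bigr => r _.
  rewrite big_seq_fset1 mcoeffUU addr0 mulr0z addr0 comp_polyXr -/(dterm r _); over.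
by rewrite msupp_sum_coef // => ->; rewrite mul0r.
Qed.

Lemma cocycle_dterm r s f g :
  cocycle (dterm r f) (dterm s g) = if s == - r then cocycle_term r f g else 0.
Proof.
have ct0r t h : cocycle_term t h 0 = 0 :> K.
  case: t => t; rewrite /cocycle_term ?oppr_eq0 big1 ?oppr0 // => m _.
    by rewrite horner0 mulr0.
  by rewrite horner0 mul0r.
have ct0l t h : cocycle_term t 0 h = 0 :> K.
  case: t => t; rewrite /cocycle_term ?oppr_eq0 big1 ?oppr0 // => m _.
    by rewrite horner0 mul0r.
  by rewrite horner0 mulr0.
rewrite /cocycle /dterm msuppU; have [->|f0] := eqVneq f 0.
  by rewrite big_nil ct0l if_same.
rewrite big_seq_fset1 mcoeffUU -/(dterm s g) dterm_coef.
by case: eqP.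
Qed.

End Diffop.

Section LieAlgebra.
Variables (K : numFieldType) (p : {poly K}) (c : K) (sgn : bool).
Hypothesis p_neq0 : p != 0.
Hypothesis p_sym : p = (-1) ^+ deg p *: (p \Po (- 'X + c%:P)).
Implicit Types (u w q : {poly K}) (k r s : int) (x y : dhat K).

Local Notation L := (dhat_pm sgn p c).
Local Notation Lg := (dhat_pm_deg sgn p c).

Definition parity (a : K) q := reflect_poly q = a *: q.

(** The parity required of [u] for [elt k u] to lie in the Lie algebra. *)
Definition sign_of k : K := - ((-1) ^+ deg p * ((-1) ^+ sgn) ^ k).

(** The fixed point of D -> -D - k + c, the substitution made by the anti-involution in degree
    [k]. *)
Definition center k : K := (c - k%:~R) / 2.

Definition centered_p := shift (c / 2) p.

Definition elt k u : dhat K := (dterm k (shift (- center k) u * p), 0).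

Definition central (z : K) : dhat K := (0, z).

Lemma parityM a b u w : parity a u -> parity b w -> parity (a * b) (u * w).
Proof.
by move=> ua wb; rewrite /parity rmorphM /= ua wb -scalerAl -scalerAr scalerA.
Qed.

Lemma parityP a t u w : parity a u -> parity a w -> parity a (t *: u + w).
Proof.
by move=> ua wa; rewrite /parity linearP /= ua wa scalerDr !scalerA mulrC.
Qed.

Lemma parity0 a : parity a 0.
Proof. by rewrite /parity raddf0 scaler0. Qed.

Lemma centered_p_neq0 : centered_p != 0.
Proof. by rewrite shift_eq0. Qed.

Lemma parity_centered_p : parity ((-1) ^+ deg p) centered_p.
Proof.
move: p_sym; rewrite /parity /centered_p; move: (deg p) => n pE.
rewrite {2}pE linearZ /= scalerA -exprMn mulrNN mulr1.
rewrite expr1n scale1r /reflect_poly /shift /= -!comp_polyA; congr comp_poly.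
rewrite !(raddfD, raddfN) /= !comp_polyX !comp_polyC opprD -addrA -polyCN -polyCD.
by congr (_ + polyC _); field.
Qed.

Lemma sqr_sgn_exp k : ((-1) ^+ sgn) ^ k * ((-1) ^+ sgn) ^ k = 1 :> K.
Proof.
by rewrite -expfzMl -signr_addb addbb exp1rz.
Qed.

Lemma sqr_sign_of k : sign_of k * sign_of k = 1.
Proof.
by rewrite /sign_of mulrNN mulrACA sqr_sgn_exp mulr1 -exprMn mulrNN mulr1 expr1n.
Qed.

Lemma sign_ofN k : sign_of (- k) = sign_of k.
Proof.
rewrite /sign_of; congr (- (_ * _)); rewrite -exprz_inv; congr (_ ^ _).
by case: sgn; rewrite /= ?expr1 ?expr0 ?invrN ?invr1.
Qed.

Lemma sign_ofD r s : sign_of (r + s) = - (sign_of r * (-1) ^+ deg p * sign_of s).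
Proof.
have NN : (-1) ^+ deg p * (-1) ^+ deg p = 1 :> K.
  by rewrite -exprMn mulrNN mulr1 expr1n.
rewrite /sign_of expfzDr ?signr_eq0 //; set N := (-1) ^+ deg p in NN *.
set a := _ ^ r; set b := _ ^ s.
by transitivity (- (N * N * (N * (a * b)))); [rewrite NN mul1r | ring].
Qed.

Lemma eltP k a u w : elt k (a *: u + w) = a *: elt k u + elt k w.
Proof.
congr pair; last by rewrite /= scaler0 addr0.
by rewrite linearP mulrDl -scalerAl dtermP.
Qed.

Lemma elt0 k : elt k 0 = 0.
Proof. by rewrite /elt raddf0 mul0r dterm0. Qed.

(** Since p is nonzero it cancels from sigma(d) = -d; centring at the fixed point turns what is left
    into a parity condition. *)
Lemma Dp_pmE d : Dp_pm sgn p c d <-> exists e : diffop K, forall k,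
  d@_k = e@_k * p /\ parity (sign_of k) (shift (center k) e@_k).
Proof.
have coef_sigma e k : (sigma sgn p c e)@_k =
    (- sign_of k) *: (reflect_poly (shift (c - k%:~R) e@_k) * p).
  rewrite /sigma; under eq_bigr do rewrite -/(dterm _ _).
  rewrite msupp_sum_coef => [|->]; last by rewrite comp_poly0 mul0r scaler0.
  rewrite /sign_of opprK /reflect_poly /shift -comp_polyA; congr (_ *: (_ * _)).
  congr comp_poly; rewrite !(raddfD, raddfN) /= comp_polyX comp_polyC.
  by ring.
have parityE e k : parity (sign_of k) (shift (center k) e@_k) <->
    (- sign_of k) *: (reflect_poly (shift (c - k%:~R) e@_k)) = - e@_k.
  have -> : reflect_poly (shift (c - k%:~R) e@_k) =
      shift (- center k) (reflect_poly (shift (center k) e@_k)).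
    by rewrite -reflect_shift shift_shift /center; congr (reflect_poly (shift _ _)); field.
  rewrite /parity; split=> [->|].
    by rewrite linearZ /= shiftK scalerA mulNr sqr_sign_of scaleN1r.
  move/(congr1 (fun q => - sign_of k *: shift (center k) q)).
  rewrite linearZ /= scalerA mulrNN sqr_sign_of scale1r shift_shift addrN shift0 => ->.
  by rewrite (raddfN (shift (center k))) scalerN scaleNr opprK.
split=> [[e -> se]|[e de]].
  exists e => k; split; first exact: dmul_dterm0_coef.
  apply/parityE; apply: (mulIf p_neq0); rewrite -scalerAl mulNr -(dmul_dterm0_coef e p k).
  by rewrite -coef_sigma se; exact: mcoeffN.
exists e; first by apply/malgP => k; rewrite dmul_dterm0_coef; case: (de k).
apply/malgP => k; rewrite coef_sigma mcoeffN (de k).1 -mulNr scalerAl.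
by rewrite (parityE e k).1 //; case: (de k).
Qed.

Lemma Dp_pm_elt k u : parity (sign_of k) u -> Dp_pm sgn p c (elt k u).1.
Proof.
move=> uk; apply/Dp_pmE; exists (dterm k (shift (- center k) u)) => j /=.
rewrite !dterm_coef; case: eqP => [<-|_]; last first.
  by rewrite mul0r raddf0; split=> //; exact: parity0.
by split=> //; rewrite shift_shift addrN shift0.
Qed.

Lemma dhat_pm_subspace : is_subspace L.
Proof.
split=> [|a x y /Dp_pmE[e xe] /Dp_pmE[f yf]]; apply/Dp_pmE.
  by exists 0 => k; rewrite !diffop_coef0 mul0r raddf0; split=> //; exact: parity0.
exists (a *: e + f) => k /=; rewrite !diffopD_coef !diffopZ_coef.
have [-> ek] := xe k; have [-> fk] := yf k.
by rewrite mulrDl -scalerAl linearP; split=> //; exact: parityP.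
Qed.

Lemma dhat_pm_deg_sub k : Lg k `<=` L.
Proof. by move=> x []. Qed.

Lemma elt_deg k u z : parity (sign_of k) u -> (k != 0 -> z = 0) ->
  Lg k (elt k u + central z).
Proof.
move=> uk z0; split; rewrite /= ?addr0 ?add0r //; first exact: Dp_pm_elt.
by eexists.
Qed.

Lemma elt_deg0 k u : parity (sign_of k) u -> Lg k (elt k u).
Proof. by move=> uk; rewrite -[elt k u]addr0; apply: (@elt_deg k u 0). Qed.

Lemma central_deg z : Lg 0 (central z).
Proof.
rewrite -[central z]add0r -(elt0 0); apply: elt_deg => //; exact: parity0.
Qed.

Lemma dhat_pm_degE k x : Lg k x ->
  exists u z, [/\ parity (sign_of k) u, k != 0 -> z = 0 & x = elt k u + central z].
Proof.
case: x => d z [/= /Dp_pmE[e de] [f df] z0].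
exists (shift (center k) e@_k), z; split=> //; first by case: (de k).
rewrite /elt shiftK; congr pair; rewrite ?add0r // addr0 df; congr dterm.
by have [<- _] := de k; rewrite df dterm_coef eqxx.
Qed.

Lemma dhat_pm_decomp x : L x -> exists (t : seq int) (f : int -> dhat K),
  (forall k, Lg k (f k)) /\ x = \sum_(k <- t) f k + central x.2.
Proof.
case: x => d z /= /Dp_pmE[e de]; exists (msupp d), (fun k => (dterm k d@_k, 0)).
split=> [k|].
  have -> : (dterm k d@_k, 0 : K^o) = elt k (shift (center k) e@_k).
    by rewrite /elt shiftK; case: (de k) => ->.
  by apply: elt_deg0; case: (de k).
rewrite -[LHS]addr0; apply: etrans (_ : (d, 0) + central z = _).
  by congr pair; rewrite /= ?addr0 ?add0r.
congr (_ + _); rewrite [in LHS](monalgE d); elim: (enum_fset _) => [|k t IHt].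
  by rewrite !big_nil.
by rewrite !big_cons -IHt; congr pair; rewrite /= addr0.
Qed.

(** The polynomial of the bracket of [elt r u] and [elt s w]. One factor p is taken out, and the
    other becomes the shifted [centered_p]; half-integral shifts appear because the variable is
    recentred for degree r + s. *)
Definition brp r s u w :=
  shift (s%:~R / 2) u * shift ((s%:~R - r%:~R) / 2) centered_p * shift (- (r%:~R / 2)) w
  - shift (r%:~R / 2) w * shift ((r%:~R - s%:~R) / 2) centered_p * shift (- (s%:~R / 2)) u.

(** Reflection exchanges the two products up to one common sign, so it multiplies their difference
    by minus that sign. *)
Lemma parity_brp r s u w :
  parity (sign_of r) u -> parity (sign_of s) w -> parity (sign_of (r + s)) (brp r s u w).
Proof.
rewrite /parity => ur ws; rewrite /brp; move: parity_centered_p; rewrite /parity.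
move: centered_p => P pE; rewrite rmorphB !rmorphM /= !reflect_shift ur ws.
rewrite pE !linearZ /= sign_ofD !opprK.
have subN t t' : - ((t - t') / 2) = (t' - t) / 2 :> K by ring.
rewrite !subN.
rewrite -!mul_polyC; ring.
Qed.

Lemma dhat_bracket_elt r s u w z z' :
  dhat_bracket (elt r u + central z) (elt s w + central z') =
  elt (r + s) (brp r s u w) + central (cocycle (elt r u).1 (elt s w).1).
Proof.
rewrite /dhat_bracket /= !addr0; congr pair; last by rewrite /= add0r.
rewrite /= addr0.
rewrite !dmul_dterm [s + r]addrC -!/(shift _ _).
apply/malgP => j; rewrite [LHS]mcoeffB !dterm_coef; case: eqP => _; last by rewrite subr0.
rewrite /brp rmorphB !rmorphM /= /centered_p !shift_shift mulrBl /center.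
(* Each total shift is the common shift centring degree r + s followed by the one in [brp]; for p, a
   further c / 2 comes from [centered_p]. *)
have sE : s%:~R + - ((c - r%:~R) / 2) = - ((c - (r + s)%:~R) / 2) + s%:~R / 2 :> K.
  by rewrite rmorphD /=; field.
have rE : r%:~R + - ((c - s%:~R) / 2) = - ((c - (r + s)%:~R) / 2) + r%:~R / 2 :> K.
  by rewrite rmorphD /=; field.
have sE' : - ((c - s%:~R) / 2) = - ((c - (r + s)%:~R) / 2) + - (r%:~R / 2) :> K.
  by rewrite rmorphD /=; field.
have rE' : - ((c - r%:~R) / 2) = - ((c - (r + s)%:~R) / 2) + - (s%:~R / 2) :> K.
  by rewrite rmorphD /=; field.
have spE : s%:~R = - ((c - (r + s)%:~R) / 2) + (s%:~R - r%:~R) / 2 + c / 2 :> K.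
  by rewrite rmorphD /=; field.
have rpE : r%:~R = - ((c - (r + s)%:~R) / 2) + (r%:~R - s%:~R) / 2 + c / 2 :> K.
  by rewrite rmorphD /=; field.
rewrite sE rE sE' rE' -spE -rpE; ring.
Qed.


End LieAlgebra.

(** * Brackets of opposite degrees and the labels *)

Section Labels.
Variables (K : numFieldType) (p : {poly K}) (c : K) (sgn : bool).
Hypothesis p_neq0 : p != 0.
Hypothesis p_sym : p = (-1) ^+ deg p *: (p \Po (- 'X + c%:P)).
Implicit Types (u w q : {poly K}) (k r s : int) (x y : dhat K).

Local Notation L := (dhat_pm sgn p c).
Local Notation Lg := (dhat_pm_deg sgn p c).
Local Notation sign_of := (sign_of p sgn).
Local Notation elt := (elt p c).
Local Notation P := (centered_p p c).

Definition cocycle_poly (k : nat) : {poly K} :=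
  \prod_(1 <= m < k.+1) ('X - ((k%:R - c) / 2 - m%:R)%:P).

Lemma cocycle_poly_neq0 n : cocycle_poly n != 0.
Proof. by rewrite monic_neq0 // monic_prod => // m _; exact: monicXsubC. Qed.

(** The centrings in degrees k and -k send -m and -m + k to the same point, a root of
    [cocycle_poly k], so each summand of the cocycle contains a value of u * w at such a root. *)
Lemma cocycle_elt_opp (k : nat) u w : cocycle_poly k %| u * w ->
  cocycle (elt k u).1 (elt (- k%:Z) w).1 = 0.
Proof.
move=> kuw; rewrite cocycle_dterm eqxx /cocycle_term big_nat big1 // => m /andP[m1 mk].
have : root (u * w) ((k%:R - c) / 2 - m%:R).
  rewrite root_factor_theorem; apply: dvdp_trans kuw.
  rewrite /cocycle_poly (big_rem m) ?mem_index_iota ?m1 //=.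
  by rewrite dvdp_mulIl.
rewrite rootE hornerM => uw0; rewrite !hornerM !horner_shift /center.
set a := _.[_] in uw0; set b := _.[_] in uw0.
have -> : - m%:R + - ((c - k%:~R) / 2) = (k%:R - c) / 2 - m%:R :> K by field.
have -> : - m%:R + k%:R + - ((c - (- k%:Z)%:~R) / 2) = (k%:R - c) / 2 - m%:R :> K.
  by rewrite rmorphN /=; field.
by rewrite mulrACA -/a -/b (eqP uw0) mul0r.
Qed.

Lemma cocycle_elt_eq0 r s u w : r + s != 0 -> cocycle (elt r u).1 (elt s w).1 = 0.
Proof. by rewrite cocycle_dterm addrC addr_eq0 => /negPf->. Qed.

Lemma dhat_bracket_deg r s x y :
  Lg r x -> Lg s y -> Lg (r + s) (dhat_bracket x y).
Proof.
move=> /(dhat_pm_degE p_neq0)[u [z [ur _ ->]]] /(dhat_pm_degE p_neq0)[w [z' [ws _ ->]]].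
rewrite dhat_bracket_elt; apply: elt_deg; first exact: p_neq0.
  exact: parity_brp.
exact: cocycle_elt_eq0.
Qed.

(** In opposite degrees the second product is the reflection of the first up to sign, so [u] and [w]
    enter only through their product. *)
Lemma brp_oppE k u w : parity (sign_of k) u -> parity (sign_of (- k)) w ->
  brp p c k (- k) u w =
  let W := shift (- (k%:~R / 2)) (u * w) * shift (- k%:~R) P in
  W - (-1) ^+ deg p *: reflect_poly W.
Proof.
rewrite sign_ofN // /parity => uk wk /=; rewrite /brp.
move: (parity_centered_p p_sym); rewrite /parity; move: P => Q Qp.
rewrite !rmorphM /= !reflect_shift uk wk !opprK.
rewrite Qp.
have e1 : ((- k)%:~R - k%:~R) / 2 = - k%:~R :> K by rewrite rmorphN /=; field.
have e2 : (k%:~R - (- k)%:~R) / 2 = k%:~R :> K by rewrite rmorphN /=; field.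
have e3 : (- k)%:~R / 2 = - (k%:~R / 2) :> K by rewrite rmorphN /=; field.
rewrite e1 e2 e3 opprK !linearZ /= scalerN; congr (_ - _); first by ring.
have NN : (-1) ^+ deg p * (-1) ^+ deg p = 1 :> K.
  by rewrite -exprMn mulrNN mulr1 expr1n.
have EE := sqr_sign_of p sgn k.
rewrite -!mul_polyC; set U := shift _ u; set W := shift _ w; set Qk := shift _ Q.
transitivity (((-1) ^+ deg p * (-1) ^+ deg p)%:P * (sign_of k * sign_of k)%:P
              * (W * Qk * U)); first by rewrite NN EE !mul1r.
by ring.
Qed.

Variable lam : dhat K -> K.
Hypothesis lam_linear : linear_on (Lg 0) lam.
Local Notation Delta := (label_series p c lam).

Lemma lam0 : lam 0 = 0.
Proof.
have L0 : Lg 0 0 by rewrite -(elt0 p c 0); exact/elt_deg0/parity0.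
by have := lam_linear 1 L0 L0; rewrite scaler0 addr0 mul1r -[LHS]addr0 => /addrI.
Qed.

Lemma label_series0 n : (-1) ^+ n != sign_of 0 -> Delta n = 0.
Proof.
rewrite /label_series /sign_of expr0z mulr1 -[_ ^+ n]signr_odd -[_ ^+ deg p]signr_odd.
by case: (odd n); case: (odd _); rewrite //= ?expr1 ?expr0 ?opprK ?eqxx.
Qed.

Lemma label_series_reflect q : pairing Delta (reflect_poly q) = sign_of 0 * pairing Delta q.
Proof.
apply: (poly_functional_ext (f := pairing Delta \o @reflect_poly K)
         (g := fun q => sign_of 0 * pairing Delta q)).
- by move=> a u w /=; rewrite !linearP.
- by move=> a u w /=; rewrite linearP /=; ring.
move=> n /=; rewrite rmorphXn /= reflectX -scaleN1r exprZn linearZ /= pairingXn.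
by have [->|/label_series0->] := eqVneq ((-1) ^+ n) (sign_of 0); rewrite ?mulr0.
Qed.

(** The factorials in [pairing] cancel those in the series, leaving the labels. *)
Lemma pairing_label_series q : parity (sign_of 0) q ->
  pairing Delta q = - lam (elt 0 q).
Proof.
move=> q0; have q_i i : (-1) ^+ i != sign_of 0 -> q`_i = 0.
  move=> ne; have /(congr1 (fun t : {poly K} => t`_i)) := q0.
  rewrite coef_reflect coefZ => /eqP; rewrite -subr_eq0 -mulrBl mulf_eq0 subr_eq0.
  by rewrite (negPf ne) => /eqP.
have X0 i : (-1) ^+ i = sign_of 0 -> parity (sign_of 0) 'X^i.
  by move=> <-; rewrite /parity rmorphXn /= reflectX -scaleN1r exprZn.
rewrite /pairing.
rewrite -[q in elt 0 q]coefK poly_def.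
(* [lam] is linear on the degree 0 part only, so the induction also carries the parity of each
   partial sum. *)
suff H (t : seq 'I_(size q)) :
    parity (sign_of 0) (\sum_(i <- t) q`_i *: 'X^i) /\
    \sum_(i <- t) q`_i * (i`!%:R * Delta i) = - lam (elt 0 (\sum_(i <- t) q`_i *: 'X^i)).
  exact: (H _).2.
elim: t => [|i t [IH1 IH2]].
  by rewrite !big_nil elt0 lam0 oppr0; split=> //; exact: parity0.
rewrite !big_cons IH2; have [/[dup] Ei /X0 Xi|ne] := eqVneq ((-1) ^+ i) (sign_of 0); last first.
  by rewrite q_i // mul0r scale0r !add0r.
split; first exact: parityP.
rewrite eltP (lam_linear _ (elt_deg0 c p_neq0 Xi) (elt_deg0 c p_neq0 IH1)) // opprD -mulrN.
congr (_ * _ + _); rewrite /label_series.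
have -> : odd i == ~~ odd (deg p).
  move: Ei; rewrite /sign_of expr0z mulr1 -[_ ^+ i]signr_odd -[_ ^+ deg p]signr_odd.
  by rewrite -signrN => /signr_inj ->.
rewrite mulrC divfK ?fact_neq0 // /label /elt /center subr0.
by rewrite rmorphXn /= shiftX polyCN.
Qed.

Lemma lam_bracket_elt (k : nat) u w :
  parity (sign_of k) u -> parity (sign_of (- k%:Z)) w -> cocycle_poly k %| u * w ->
  let W := shift (- (k%:R / 2)) (u * w) * shift (- k%:R) P in
  lam (dhat_bracket (elt k u) (elt (- k%:Z) w)) =
  - pairing Delta (W - (-1) ^+ deg p *: reflect_poly W).
Proof.
move=> uk wk kuw W; have WE := brp_oppE uk wk.
have := dhat_bracket_elt p c k (- k%:Z) u w 0 0.
rewrite /central !addr0 cocycle_elt_opp // addr0 subrr => ->.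
rewrite -[LHS]opprK -pairing_label_series; last first.
  by have := parity_brp p_sym uk wk; rewrite subrr.
by rewrite WE.
Qed.

End Labels.

Section DivisionBy2Sinh.
Variable K : numFieldType.

(** The series 2 sinh(x/2) starts with x, so coefficient n + 1 of the product and the earlier
    coefficients of [u] determine its coefficient n. *)
Lemma fps_mul_2sinh_inj : injective (fps_mul (fps_2sinh_half K)).
Proof.
move=> u v uv; apply/funext => n; elim/ltn_ind: n => n IHn.
have := congr1 (fun w => w n.+1) uv; rewrite /fps_mul !big_ord_recl /=.
have -> : fps_2sinh_half K 0 = 0.
  by rewrite /fps_2sinh_half /fps_exp !expr0 subrr.
have -> : fps_2sinh_half K (bump 0 0) = 1.
  by rewrite /fps_2sinh_half /fps_exp /bump /= factS fact0 !expr1; field.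
rewrite !mul0r !add0r !mul1r /bump /= !add1n subSS subn0.
rewrite (eq_bigr (fun i : 'I_n => fps_2sinh_half K i.+2 * v (n.+1 - i.+2)%N)).
  exact: addIr.
by move=> i _; rewrite /= !add1n IHn // subSS; case: i => i /=; lia.
Qed.

Lemma fps_div_2sinh_half u v :
  fps_mul (fps_2sinh_half K) u = v -> fps_div v (fps_2sinh_half K) = u.
Proof.
move=> uv; apply: xget_unique => // w wv; apply: fps_mul_2sinh_inj.
by rewrite uv.
Qed.

End DivisionBy2Sinh.

(** * The form of the label series and the vanishing of its functional *)

Section LabelSeriesForm.
Variables (K : numClosedFieldType) (p : {poly K}) (c : K).
Hypothesis p_neq0 : p != 0.
Hypothesis p_sym : p = (-1) ^+ deg p *: (p \Po (- 'X + c%:P)).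
Implicit Types (q e : {poly K}) (u : nat -> K).
Local Notation P := (centered_p p c).
Local Notation S := (fps_2sinh_half K).

Lemma pairing_diffop_centered u q :
  pairing (fps_diffop p (c / 2) u) q = pairing u (q * P).
Proof. by rewrite pairing_diffop. Qed.

Lemma label_series_form_of_vanishing Delta h :
  (forall q, pairing Delta (reflect_poly q) = - (-1) ^+ deg p * pairing Delta q) ->
  h != 0 -> parity 1 h ->
  (forall e, parity 1 e ->
     pairing Delta (shift (- 2^-1) (h * e) * shift (- 1) P) = 0) ->
  exists phi : nat -> K, [/\ quasipolynomial phi, fps_even phi, phi 0 = 0
    & Delta = fps_diffop p (c / 2) (fps_div phi S)].
Proof.
move=> DeltaR h0 h1 hD; have PR := parity_centered_p p_sym.
have P0 := centered_p_neq0 c p_neq0.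
have NN : (-1) ^+ deg p * (-1) ^+ deg p = 1 :> K.
  by rewrite -exprMn mulrNN mulr1 expr1n.
(* [M] is the functional of the future Theta. Division by [P] is a linear left inverse of
   multiplication by [P]; antisymmetrising makes [M] odd and keeps its values on multiples of [P],
   because [Delta] and [P] have opposite parities. *)
pose M q := (pairing Delta (q %/ P) - pairing Delta (reflect_poly q %/ P)) / 2.
have M_scalar : scalar M.
  move=> a q r; rewrite /M linearP !divpD !divpZl !linearP /=; by field.
have MP q : M (q * P) = pairing Delta q.
  rewrite /M mulpK // rmorphM /= (PR : reflect_poly P = _) -scalerAr scalerAl mulpK //.
  by rewrite linearZ /= DeltaR mulrA mulrN NN; field.
have MR q : M (reflect_poly q) = - M q.
  by rewrite /M reflectK; field.
pose Theta := fps_of_functional M.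
have ThetaE : pairing Theta =1 M := pairing_of_functional M_scalar.
pose phi := fps_mul S Theta.
have phiE q : pairing phi q = M (shift 2^-1 q) - M (shift (- 2^-1) q).
  by rewrite pairing_mul_2sinh linearB /= !ThetaE.
have phiR q : pairing phi (reflect_poly q) = pairing phi q.
  by rewrite !phiE -[2^-1 in LHS]opprK -!reflect_shift !MR opprK opprK addrC.
(* Under the shift by -1/2 the first shifted [P] becomes [P], which [M] absorbs, and the second
   becomes the [shift (- 1) P] of the hypothesis. *)
pose r := h * (shift (2^-1) P * shift (- 2^-1) P).
have r_even : parity 1 r.
  rewrite -[1]mulr1; apply: parityM => //; move: PR; rewrite /parity.
  move: P => Q QR; rewrite rmorphM /= !reflect_shift opprK QR !linearZ /=.
  by rewrite -scalerAl -scalerAr scalerA NN mulrC.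
have even0 e : parity 1 e -> pairing phi (r * e) = 0.
  move=> e1; have re : reflect_poly (r * e) = r * e.
    by have := parityM r_even e1; rewrite /parity mulr1 scale1r.
  (* On an even polynomial, oddness of [M] makes the values at the two shifts opposite. *)
  have -> : pairing phi (r * e) = - (M (shift (- 2^-1) (r * e)) *+ 2).
    rewrite phiE -{1}[2^-1]opprK -{1}re -reflect_shift MR mulr2n opprD.
    by [].
  have -> : shift (- 2^-1) (r * e) = shift (- 2^-1) (h * e) * shift (- 1) P * P.
    rewrite /r; move: P => Q; rewrite !rmorphM /= !shift_shift addNr shift0.
    have -> : - 2^-1 + - 2^-1 = - 1 :> K by field.
    ring.
  by rewrite MP hD // mul0rn oppr0.
(* As [phi] and [r] are even, only the even part of [q] contributes. *)
have phi_ann : annihilates r phi.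
  move=> q; apply: (mulIf (x := 2)); first by rewrite pnatr_eq0.
  rewrite mul0r -[RHS](even0 (q + reflect_poly q)); last first.
    by rewrite /parity raddfD /= reflectK addrC scale1r.
  have rR : reflect_poly (r * q) = r * reflect_poly q.
    by rewrite rmorphM /= (r_even : reflect_poly r = _) scale1r.
  by rewrite [in RHS]mulrDr [RHS]linearD /= -rR phiR mulr_natr mulr2n.
exists phi; split.
- apply: (quasipolynomial_of_annihilated (r := r)) => //.
  by rewrite !mulf_neq0 ?shift_eq0.
- move=> k; apply: (mulfI (fact_neq0 K k)).
  rewrite mulrCA -pairingXn -[RHS]phiR rmorphXn /= reflectX.
  by rewrite -scaleN1r exprZn linearZ.
- have := pairingXn phi 0; rewrite fact0 mul1r expr0 => <-.
  by rewrite phiE !rmorph1 subrr.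
rewrite (fps_div_2sinh_half (u := Theta)) //.
by apply: pairing_inj => q; rewrite pairing_diffop_centered ThetaE MP.
Qed.

(** The shifts by k/2 and -k/2 are joined by k unit steps. Each step is a pairing with 2 sinh(x/2)
    Theta, which has an annihilator. *)
Lemma vanishing_of_label_series_form phi Delta (k : nat) :
  quasipolynomial phi -> Delta = fps_diffop p (c / 2) (fps_div phi S) ->
  exists2 g : {poly K}, g != 0 & forall q, parity 1 q -> g %| q ->
    let W := shift (- (k%:R / 2)) q * shift (- k%:R) P in
    pairing Delta (W - (-1) ^+ deg p *: reflect_poly W) = 0.
Proof.
set Theta := fps_div _ _ => phi_qp ->; have PR := parity_centered_p p_sym.
have [r r0 rTheta] : exists2 r : {poly K}, r != 0 & annihilates r (fps_mul S Theta).
  rewrite /Theta /fps_div; case: xgetP => [w _ ->|_].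
    exact: annihilated_of_quasipolynomial.
  (* The junk value of the division is the zero series. *)
  exists 1; rewrite ?oner_eq0 // => q; rewrite /pairing big1 // => i _.
  by rewrite /fps_mul big1 ?mulr0 // => j _; rewrite mulr0.
(* One factor per unit step, placed so that the shift to the midpoint of the step turns it into
   [r]. *)
exists (\prod_(j < k) shift (- (k%:R / 2 - 2^-1 - j%:R)) r).
  by apply/prodf_neq0 => j _; rewrite shift_eq0.
(* Multiplied by [P], [W] and its signed reflection are the shifts of [s] by -k/2 and k/2. *)
move=> q q1 gq W; pose s := q * (shift (k%:R / 2) P * shift (- (k%:R / 2)) P).
have shift_s j : (j <= k)%N ->
    pairing Theta (shift (k%:R / 2 - j%:R) s) = pairing Theta (shift (k%:R / 2) s).
  elim: j => [|j IHj] jk; first by rewrite subr0.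
  rewrite -IHj ?(ltnW jk) //; apply/esym/eqP; rewrite -subr_eq0 -linearB /=.
  set b : K := k%:R / 2 - 2^-1 - j%:R.
  have -> : k%:R / 2 - j%:R = 2^-1 + b :> K by rewrite /b; field.
  have -> : k%:R / 2 - j.+1%:R = - 2^-1 + b :> K by rewrite /b -natr1; field.
  rewrite -(shift_shift 2^-1) -(shift_shift (- 2^-1)) -pairing_mul_2sinh.
  have /dvdpP[t ->] : r %| shift b s; last by rewrite mulrC rTheta.
  rewrite -[r](shiftK (- b)) opprK dvdp_shift // /s dvdp_mulr //.
  apply: dvdp_trans gq; rewrite (bigD1 (Ordinal jk)) //=.
  exact: dvdp_mulIl.
have NN : (-1) ^+ deg p * (-1) ^+ deg p = 1 :> K.
  by rewrite -exprMn mulrNN mulr1 expr1n.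
rewrite pairing_diffop_centered mulrBl linearB /=.
have -> : W * P = shift (- (k%:R / 2)) s.
  rewrite /W /s; move: P => Q; rewrite !rmorphM /= !shift_shift addNr shift0.
  have -> : - (k%:R / 2) + - (k%:R / 2) = - k%:R :> K by field.
  ring.
have -> : (-1) ^+ deg p *: reflect_poly W * P = shift (k%:R / 2) s.
  rewrite /W /s; move: PR; rewrite /parity; move: P => Q QR.
  rewrite !rmorphM /= !reflect_shift !opprK (q1 : reflect_poly q = _) QR scale1r !shift_shift subrr shift0 linearZ /=.
  have -> : k%:R / 2 + k%:R / 2 = k%:R :> K by field.
  by rewrite -scalerAr scalerA NN scale1r mulrA.
rewrite -(shift_s k) //.
have -> : k%:R / 2 - k%:R = - (k%:R / 2) :> K by field.
by rewrite subrr.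
Qed.

End LabelSeriesForm.

(** * Graded modules *)

Section Subspaces.
Variables (K : fieldType) (V : lmodType K).
Implicit Types (W U : set V) (N : int -> set V).

Lemma subspaceD W u v : is_subspace W -> W u -> W v -> W (u + v).
Proof. by move=> [_ WP] Wu Wv; rewrite -[u]scale1r; apply: WP. Qed.

Lemma subspaceZ W a u : is_subspace W -> W u -> W (a *: u).
Proof. by move=> [W0 WP] Wu; rewrite -[_ *: _]addr0; apply: WP. Qed.

Lemma subspace_sum (I : eqType) W (s : seq I) (f : I -> V) : is_subspace W ->
  (forall i, i \in s -> W (f i)) -> W (\sum_(i <- s) f i).
Proof.
move=> sW Wf; rewrite big_seq.
by elim/big_ind: _ => //; [case: sW | move=> u v; apply: subspaceD].
Qed.

Lemma big_regroup (s t : seq int) (f : int -> V) : uniq t -> {subset s <= t} ->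
  \sum_(i <- s) f i = \sum_(j <- t) \sum_(i <- s | i == j) f i.
Proof.
move=> ut st; under [RHS]eq_bigr do rewrite big_mkcond.
rewrite exchange_big /= big_seq [RHS]big_seq; apply: eq_bigr => i /st it.
rewrite (big_rem i) //= eqxx big_seq big1 ?addr0 // => j.
by rewrite mem_rem_uniq // inE eq_sym => /andP[/negPf->].
Qed.

(** A decomposition may list a degree several times. Merging repetitions and enlarging the list to
    contain [t] allows comparison degree by degree. *)
Lemma sum_of_components_uniq N v (t : seq int) : (forall j, is_subspace (N j)) ->
  sum_of_components N v -> exists s f,
    [/\ uniq s, {subset t <= s}, forall j, N j (f j) & v = \sum_(j <- s) f j].
Proof.
move=> sN [s [f [Nf ->]]]; exists (undup (s ++ t)), (fun j => \sum_(i <- s | i == j) f i).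
split.
- exact: undup_uniq.
- by move=> i it; rewrite mem_undup mem_cat it orbT.
- by move=> j; elim/big_ind: _ => [|u w|i /eqP->] //; [case: (sN j) | apply: subspaceD].
- by apply: big_regroup; rewrite ?undup_uniq // => i si; rewrite mem_undup mem_cat si.
Qed.

Lemma sum_of_components_subspace N : (forall j, is_subspace (N j)) ->
  is_subspace (sum_of_components N).
Proof.
move=> sN; split.
  exists [::], (fun=> 0); split; last by rewrite big_nil.
  by move=> j; case: (sN j).
move=> a u v Nu Nv; have [s [f [us _ Nf ->]]] := sum_of_components_uniq [::] sN Nu.
have [t [g [ut st Ng ->]]] := sum_of_components_uniq s sN Nv.
exists t, (fun j => a *: (\sum_(i <- s | i == j) f i) + g j); split=> [j|].
  case: (sN j) => N0; apply=> //.
  by elim/big_ind: _ => [|x y|i /eqP->] //; apply: subspaceD.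
by rewrite (big_regroup f ut st) scaler_sumr -big_split.
Qed.

Lemma sub_sum_of_components N j : (forall j, is_subspace (N j)) ->
  N j `<=` sum_of_components N.
Proof.
move=> sN v Nv; exists [:: j], (fun i => if i == j then v else 0).
split=> [i|]; last by rewrite big_seq1 eqxx.
by case: eqP => [->|] //; case: (sN i).
Qed.

Lemma component_mem (Vg N : int -> set V) j v : is_grading Vg ->
  (forall j, is_subspace (N j)) -> (forall j, N j `<=` Vg j) ->
  sum_of_components N v -> Vg j v -> N j v.
Proof.
move=> [sV _ dV] sN NV /(sum_of_components_uniq [:: j] sN)[s [f [us js Nf vE]]] Vv.
have {}js : j \in s by apply: js; rewrite inE.
(* Subtracting [v] in degree j gives a decomposition of 0, so directness of the grading identifies
   [v] with [f j]. *)
have := dV s (fun i => if i == j then f i - v else f i) us.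
have Vf i : Vg i (if i == j then f i - v else f i).
  case: eqP => [->|_]; last exact: NV.
  apply: subspaceD => //; first exact: NV.
  by rewrite -scaleN1r; apply: subspaceZ.
move=> /(_ Vf); have -> : \sum_(i <- s) (if i == j then f i - v else f i) = 0.
  rewrite (big_rem j) //= eqxx -addrA addrCA [X in _ + X](_ : _ = v) ?addNr //.
  rewrite vE [RHS](big_rem j) //=; congr (_ + _).
  rewrite big_seq [RHS]big_seq; apply: eq_bigr => i.
  by rewrite mem_rem_uniq // inE => /andP[/negPf->].
by move=> /(_ erefl j js); rewrite eqxx => /subr0_eq <-.
Qed.

(* The span is expressed through all subspaces containing s, which passes to
   preimages under linear maps without choosing coordinates. *)
Definition fin_spanned W := exists s : seq V, (forall e, e \in s -> W e) /\
  forall U, is_subspace U -> (forall e, e \in s -> U e) -> W `<=` U.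

Lemma finite_dim_of_fin_spanned W : fin_spanned W -> finite_dim W.
Proof.
move=> [s [_ sW]]; exists (size s), (fun i => s`_i).
apply: (sW [set v | exists a : 'I_(size s) -> K, v = \sum_(i < size s) a i *: s`_i]).
  split=> [|a _ _ [f ->] [g ->]].
    by exists (fun=> 0); rewrite big1 // => i _; rewrite scale0r.
  exists (fun i => a * f i + g i); rewrite scaler_sumr -big_split.
  by apply: eq_bigr => i _ /=; rewrite scalerDl scalerA.
move=> e es; have es' : (index e s < size s)%N by rewrite index_mem.
exists (fun i => (i == Ordinal es')%:R).
rewrite (bigD1 (Ordinal es')) //= eqxx scale1r nth_index // big1 ?addr0 //.
by move=> i /negPf->; rewrite scale0r.
Qed.

End Subspaces.

(** * Submodules generated by operators of negative degree *)

Section GradedModule.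
Variables (K : fieldType) (G : lmodType K) (br : G -> G -> G).
Variables (L : set G) (Lg : int -> set G).
Variables (V : lmodType K) (act : G -> V -> V) (Vg : int -> set V).
Hypothesis gm : is_graded_module br L Lg act Vg.
Hypothesis L_subspace : is_subspace L.
Hypothesis Lg_sub : forall k, Lg k `<=` L.
Hypothesis Lg_br : forall i j x y, Lg i x -> Lg j y -> Lg (i + j) (br x y).
Hypothesis L_span : forall U : set G, is_subspace U ->
  (forall k, Lg k `<=` U) -> L `<=` U.

Lemma actP x a u v : L x -> act x (a *: u + v) = a *: act x u + act x v.
Proof. by move=> Lx; apply: (gmod_linear gm Lx). Qed.

Lemma act0r x : L x -> act x 0 = 0.
Proof.
by move=> Lx; have := actP 1 0 0 Lx; rewrite !scale1r addr0 -[LHS]addr0 => /addrI.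
Qed.

Lemma actZr x a u : L x -> act x (a *: u) = a *: act x u.
Proof. by move=> Lx; rewrite -[a *: u]addr0 actP // act0r // addr0. Qed.

Lemma act0l v : act 0 v = 0.
Proof.
have L0 : L 0 by case: L_subspace.
have := gmod_linearl gm 1 v L0 L0.
by rewrite !scale1r addr0 -[LHS]addr0 => /addrI.
Qed.

Lemma subspace_preimage x (U : set V) : L x -> is_subspace U ->
  is_subspace [set y | U (act x y)].
Proof.
move=> Lx [U0 UP]; split=> [|a u v Uu Uv] /=; first by rewrite act0r.
by rewrite actP //; apply: UP.
Qed.

(** The degree k piece of U(L_-) B, with L_- the negative part of the Lie algebra. The inductive
    form gives induction on words without the enveloping algebra. *)
Inductive neg_gen (B : int -> set V) : int -> V -> Prop :=
| NegGenBase k y of B k y : neg_gen B k y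
| NegGen0 k : neg_gen B k 0
| NegGenP k a y z of neg_gen B k y & neg_gen B k z : neg_gen B k (a *: y + z)
| NegGenAct j k x y of (j < 0)%R & Lg j x & neg_gen B k y :
    neg_gen B (j + k) (act x y).

Variable B : int -> set V.
Local Notation N := (neg_gen B).

Lemma neg_gen_subspace k : is_subspace (N k).
Proof. by split=> *; [exact: NegGen0 | exact: NegGenP]. Qed.

Lemma neg_gen_sub : (forall k, B k `<=` Vg k) -> forall k, N k `<=` Vg k.
Proof.
move=> BV k y; elim=> {k y} [k y /BV //|k|k a y z _ Vy _ Vz|j k x y _ Lx _ Vy].
- by case: (gmod_grading gm) => sV _ _; case: (sV k).
- by case: (gmod_grading gm) => sV _ _; case: (sV k) => _; apply.
- exact: (gmod_degree gm).
Qed.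

Lemma neg_gen_degree (d : int) : (forall k y, B k y -> (k <= d)%R) ->
  forall k y, N k y -> y != 0 -> (k <= d)%R.
Proof.
move=> Bd k y; elim=> {k y} [k y /Bd //|k|k a y z _ IHy _ IHz|j k x y j0 Lx _ IHy].
- by rewrite eqxx.
- have [->|/IHy //] := eqVneq y 0; have [->|/IHz //] := eqVneq z 0.
  by rewrite scaler0 addr0 eqxx.
- have [->|/IHy kd _] := eqVneq y 0; first by rewrite act0r ?eqxx //; exact: Lg_sub Lx.
  lia.
Qed.

Hypothesis B_nonneg : forall j k x y,
  (0 <= j)%R -> Lg j x -> B k y -> N (j + k) (act x y).

(* Commuting x past the outermost negative operator creates only [x, x'], which
   acts on a shorter word: no ordering of the operators is needed. *)
Lemma neg_gen_stable j k x y : Lg j x -> N k y -> N (j + k) (act x y).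
Proof.
move=> Lx Ny; elim: Ny j x Lx => {k y} [k y By|k|k a y z _ IHy _ IHz|i k x' y i0 Lx' Ny IHy] j x Lx.
- have [j0|j0] := leP 0 j; first exact: B_nonneg.
  by apply: NegGenAct => //; exact: NegGenBase.
- by rewrite act0r; [exact: NegGen0 | exact: Lg_sub Lx].
- by rewrite actP; [apply: NegGenP; [exact: IHy | exact: IHz] | exact: Lg_sub Lx].
- have -> : act x (act x' y) = 1 *: act (br x x') y + act x' (act x y).
    rewrite scale1r (gmod_bracket gm) ?subrK //; [exact: Lg_sub Lx | exact: Lg_sub Lx'].
  apply: NegGenP; first by rewrite addrA; apply: IHy; exact: Lg_br.
  by rewrite addrCA; apply: NegGenAct => //; exact: IHy.
Qed.

Lemma neg_gen_submodule : is_submodule L act (sum_of_components N).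
Proof.
have sN := sum_of_components_subspace neg_gen_subspace.
split=> // x v Lx Nv.
(* The action is linear in the operator only on [L], so membership in [L] is made part of the
   subspace. *)
apply: (L_span (U := [set x | L x /\ sum_of_components N (act x v)]) _ _ Lx).2.
  split=> [|a y z [Ly Ny] [Lz Nz]].
    by split; [case: L_subspace | rewrite act0l; case: sN].
  split; first by case: L_subspace => _; apply.
  by rewrite (gmod_linearl gm) //; case: sN => _; apply.
move=> k y Ly; split; first exact: Lg_sub Ly.
have [s [f [Nf ->]]] := Nv.
apply: (@subspace_sum _ _ _ [set w | sum_of_components N (act y w)]) => [|i _].
  by apply: subspace_preimage => //; exact: Lg_sub Ly.
apply: (@sub_sum_of_components _ _ N (k + i)); first exact: neg_gen_subspace.
exact: neg_gen_stable.
Qed.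

Lemma neg_gen_graded : (forall k, B k `<=` Vg k) ->
  is_graded_subset Vg (sum_of_components N).
Proof.
move=> BV v [s [f [Nf ->]]]; exists s, f; split=> // j; split.
  exact: neg_gen_sub.
exact/sub_sum_of_components/Nf/neg_gen_subspace.
Qed.

End GradedModule.

(** * Finite dimensionality of the pieces of a cyclic module *)

Section CyclicFiniteness.
Variables (K : fieldType) (G : lmodType K) (br : G -> G -> G).
Variables (L : set G) (Lg : int -> set G).
Variables (V : lmodType K) (act : G -> V -> V) (Vg : int -> set V).
Hypothesis gm : is_graded_module br L Lg act Vg.
Hypothesis Lg_sub : forall k, Lg k `<=` L.
Variable v : V.
Definition at_degree0 (k : int) : set V := [set y | k = 0 /\ y = v].
Local Notation N := (neg_gen Lg act at_degree0).
(** [Lg m] may be infinite dimensional; what is asked is that its image on each single vector be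
    finitely spanned. *)
Hypothesis act_fin : forall m y, (m < 0)%R -> (exists k, N k y) ->
  exists t : seq G, (forall x, x \in t -> Lg m x) /\
    forall U, is_subspace U -> (forall x, x \in t -> U (act x y)) ->
      forall x, Lg m x -> U (act x y).

Lemma cyclic_degree k y : N k y -> y != 0 -> (k <= 0)%R.
Proof. by apply: (neg_gen_degree gm Lg_sub) => j z [->]. Qed.

(** Induction on the depth n: apart from [v] itself, degree -n is spanned by operators of degree -j
    applied to degree -(n - j) with 0 < j <= n, and both can be taken from finite lists. *)
Lemma fin_spanned_cyclic k : fin_spanned (N k).
Proof.
have [k0|k0] := ltP 0 k.
  exists [::]; split=> // U [U0 _] _ y Ny.
  by have [->//|/(cyclic_degree Ny)] := eqVneq y 0; rewrite leNgt k0.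
have [n ->] : exists n : nat, k = - n%:Z by exists `|k|%N; lia.
elim/ltn_ind: n => n IHn {k k0}.
have /choice[S SP] : forall i, exists s : seq V, (i < n)%N ->
    (forall e, e \in s -> N (- i%:Z) e) /\
    forall U, is_subspace U -> (forall e, e \in s -> U e) -> N (- i%:Z) `<=` U.
  move=> i; have [/IHn[s sP]|_] := ltnP i n; last by exists [::].
  by exists s.
have /choice[T TP] : forall my : int * V, exists t : seq G,
    (my.1 < 0)%R -> (exists k, N k my.2) ->
    (forall x, x \in t -> Lg my.1 x) /\
    forall U, is_subspace U -> (forall x, x \in t -> U (act x my.2)) ->
      forall x, Lg my.1 x -> U (act x my.2).
  case=> m y /=; have [[m0 /(act_fin m0)[t tP]]|no] := pselect ((m < 0)%R /\ exists k, N k y).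
    by exists t.
  by exists [::] => m0 Ny; case: no.
have Tin j i e : (0 < j)%N -> (i < n)%N -> e \in S i ->
    (forall x, x \in T (- j%:Z, e) -> Lg (- j%:Z) x) /\
    forall U, is_subspace U -> (forall x, x \in T (- j%:Z, e) -> U (act x e)) ->
      forall x, Lg (- j%:Z) x -> U (act x e).
  move=> j0 iltn eS; apply: TP => /=; first lia.
  by exists (- i%:Z); apply: (SP i iltn).1.
pose word j e := [seq act x e | x <- T (- j%:Z, e)].
pose words := flatten [seq flatten [seq word j e | e <- S (n - j)%N] | j <- iota 1 n].
have wordsP y : reflect (exists j e x, [/\ (0 < j <= n)%N, e \in S (n - j)%N,
    x \in T (- j%:Z, e) & y = act x e]) (y \in words).
  apply: (iffP flatten_mapP) => [[j]|[j [e [x [jn eS xT ->]]]]].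
    rewrite mem_iota add1n ltnS => jn /flatten_mapP[e eS /mapP[x xT ->]].
    by exists j, e, x.
  exists j; first by rewrite mem_iota add1n ltnS.
  by apply/flatten_mapP; exists e => //; apply: map_f.
exists ((if n == 0%N then [:: v] else [::]) ++ words); split=> [y|U sU Uwords].
  rewrite mem_cat => /orP[|/wordsP[j [e [x [jn eS xT ->]]]]].
    case: eqP => // ->; rewrite inE => /eqP ->; exact: NegGenBase.
  have jlt : (n - j < n)%N by lia.
  have -> : - n%:Z = - j%:Z + - (n - j)%N%:Z by lia.
  apply: NegGenAct; first lia.
    by apply: (Tin _ _ _ _ jlt eS).1 => //; lia.
  exact: (SP _ jlt).1.
suff H k y : N k y -> k = - n%:Z -> U y by move=> y Ny; exact: (H _ _ Ny).
have [U0 UP] := sU.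
elim=> {k y} [k y [-> ->] n0|//|k a y z _ Uy _ Uz kn|j k x y j0 Lx Ny _ jk].
- have {}n0 : n = 0%N by lia.
  by apply: Uwords; rewrite n0 inE eqxx.
- by apply: UP; [exact: Uy | exact: Uz].
have [->|y0] := eqVneq y 0; first by rewrite (act0r gm) //; exact: Lg_sub Lx.
have k0 := cyclic_degree Ny y0.
have [m mE] : exists m : nat, j = - m%:Z by exists `|j|%N; lia.
have kE : k = - (n - m)%N%:Z by lia.
have mn : (0 < m <= n)%N by lia.
have nmn : (n - m < n)%N by lia.
(* Linearity in the vector reduces [y] to the finite list in degree -(n - m); afterwards the
   operator is reduced to the list attached to that vector. *)
apply: ((SP _ nmn).2 [set z | U (act x z)]); last by rewrite -kE.
  by apply: (subspace_preimage gm) => //; exact: Lg_sub Lx.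
move=> e eS /=; apply: (Tin m _ _ _ nmn eS).2 => //; last by rewrite -mE.
  by case/andP: mn.
move=> x' x'T; apply: Uwords; rewrite mem_cat; apply/orP; right.
by apply/wordsP; exists m, e, x'.
Qed.

End CyclicFiniteness.

(** * Polynomials of a given parity *)

Section ParityPart.
Variable K : numFieldType.
Implicit Types (a : K) (q b : {poly K}).

Definition parity_part a q := 2^-1 *: (q + a *: reflect_poly q).

Lemma parity_partP a t q r :
  parity_part a (t *: q + r) = t *: parity_part a q + parity_part a r.
Proof.
by rewrite /parity_part linearP /= -!mul_polyC; ring.
Qed.

Lemma parity_parity_part a q : a * a = 1 -> parity a (parity_part a q).
Proof.
move=> aa; rewrite /parity /parity_part linearZ /= raddfD /= linearZ /= reflectK.
rewrite scalerA [a * _]mulrC -scalerA; congr (_ *: _).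
by rewrite scalerDr scalerA aa scale1r addrC.
Qed.

Lemma parity_part_id a q : a * a = 1 -> parity a q -> parity_part a q = q.
Proof.
move=> aa qa; rewrite /parity_part (qa : reflect_poly q = _) scalerA aa scale1r.
by rewrite -mulr2n -scaler_nat scalerA mulVf ?scale1r ?pnatr_eq0.
Qed.

Lemma parity_part_mul_even a q b :
  parity 1 b -> parity_part a (q * b) = parity_part a q * b.
Proof.
move=> b1; rewrite /parity_part rmorphM /= (b1 : reflect_poly b = _) scale1r.
by rewrite -scalerAl mulrDl -scalerAl.
Qed.

Lemma even_mul_reflect b : parity 1 (b * reflect_poly b).
Proof. by rewrite /parity rmorphM /= reflectK scale1r mulrC. Qed.

(** Division by [b] times its reflection, an even multiple of [b], is compatible with parity parts,
    and the remainder has bounded degree. *)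
Lemma parity_span_mod a b : a * a = 1 -> b != 0 ->
  exists n, forall U : set {poly K}, is_subspace U ->
    (forall q, parity a q -> b %| q -> U q) ->
    (forall i, (i < n)%N -> U (parity_part a 'X^i)) ->
    forall q, parity a q -> U q.
Proof.
move=> aa b0; pose b2 := b * reflect_poly b.
have b20 : b2 != 0 by rewrite mulf_neq0 ?reflect_eq0.
exists (size b2) => U sU Ub UX q qa; rewrite -(parity_part_id aa qa).
rewrite {1}(divp_eq q b2) -[_ * b2]scale1r parity_partP scale1r.
apply: subspaceD => //.
  rewrite parity_part_mul_even; last exact: even_mul_reflect.
  apply: Ub; last by rewrite mulrA mulrAC dvdp_mulIr.
  have := parityM (parity_parity_part (q %/ b2) aa) (even_mul_reflect b).
  by rewrite mulr1.
rewrite -[_ %% _]coefK poly_def.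
have : (size (q %% b2)%R <= size b2)%N by rewrite ltnW // ltn_modp.
elim: (size _) => [|n IHn] le_n.
  rewrite big_ord0 /parity_part raddf0 scaler0 addr0 scaler0; by case: sU.
rewrite big_ord_recr /= addrC parity_partP; case: (sU) => _; apply; first exact: UX.
exact/IHn/ltnW.
Qed.

(** A homogeneous system of n equations in n + 1 unknowns has a nonzero solution, and the even
    powers of X times a fixed [q0], which is 1 or X, are independent. *)
Lemma parity_linear_dependence a : a = 1 \/ a = -1 ->
  exists2 q0, parity a q0 & forall n (A : nat -> 'I_n -> K), exists t : nat -> K,
    \sum_(i < n.+1) t i *: ('X^2 ^+ i * q0) != 0 /\
    forall j, \sum_(i < n.+1) t i * A i j = 0.
Proof.
move=> a1; have [q0 [q00 q0a]] : exists q0 : {poly K}, q0 != 0 /\ parity a q0.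
  case: a1 => ->; [exists 1 | exists 'X]; rewrite ?oner_eq0 ?polyX_eq0; split=> //.
    by rewrite /parity rmorph1 scale1r.
  by rewrite /parity reflectX scaleN1r.
exists q0 => // n A; pose M : 'M[K]_(n.+1, n) := \matrix_(i, j) A i j.
have : kermx M != 0.
  rewrite kermx_eq0 -row_leq_rank -ltnNge ltnS; exact: rank_leq_col.
case/rowV0Pn => v /sub_kermxP vM v0.
exists (fun i => v 0 (inord i)); split=> // [|j]; last first.
  have := congr1 (fun B : 'rV_n => B 0 j) vM; rewrite !mxE => vMj.
  by rewrite -[RHS]vMj; apply: eq_bigr => i _; rewrite inord_val mxE.
rewrite (_ : \sum_(i < _) _ = (\sum_(i < n.+1) v 0 (inord i) *: 'X^2 ^+ i) * q0); last first.
  by rewrite mulr_suml; apply: eq_bigr => i _; rewrite scalerAl.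
apply: mulf_neq0 => //.
apply: contraNneq v0 => s0; apply/eqP/rowP => i; rewrite mxE.
have := congr1 (fun q : {poly K} => q`_(2 * i)) s0; rewrite coef0 coef_sum.
rewrite (bigD1 i) //= coefZ -exprM coefXn eqxx mulr1 big1 ?addr0 ?inord_val //.
move=> j ji; rewrite coefZ -exprM coefXn eqn_mul2l /=.
by rewrite -val_eqE /= eq_sym in ji; rewrite (negPf ji) mulr0.
Qed.

End ParityPart.

(** * The irreducible highest weight module *)

Section HighestWeightModule.
Variables (K : numClosedFieldType) (p : {poly K}) (c : K) (sgn : bool).
Hypothesis p_neq0 : p != 0.
Hypothesis p_sym : p = (-1) ^+ deg p *: (p \Po (- 'X + c%:P)).
Variable lam : dhat K -> K.
Local Notation L := (dhat_pm sgn p c).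
Local Notation Lg := (dhat_pm_deg sgn p c).
Hypothesis lam_linear : linear_on (Lg 0) lam.
Variables (V : lmodType K) (act : dhat K -> V -> V) (Vg : int -> set V).
Hypothesis gm : is_graded_module (@dhat_bracket K) L Lg act Vg.
Variable v : V.
Hypothesis v_neq0 : v != 0.
Hypothesis v_deg : Vg 0 v.
Hypothesis v_weight : forall h, Lg 0 h -> act h v = lam h *: v.
Hypothesis v_sing : forall (j : int) x, (0 < j)%R -> Lg j x -> act x v = 0.
Implicit Types (u w q : {poly K}) (j k m : int) (x : dhat K).
Local Notation sign_of := (sign_of p sgn).
Local Notation elt := (elt p c).
Local Notation P := (centered_p p c).
Local Notation Delta := (label_series p c lam).

Let Lg_sub := @dhat_pm_deg_sub K p c sgn.
Let L_subspace : is_subspace L := dhat_pm_subspace c sgn p_neq0.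

Lemma elt_L k u : parity (sign_of k) u -> L (elt k u).
Proof. by move=> uk; exact/Lg_sub/elt_deg0. Qed.

Lemma dhat_pm_span (U : set (dhat K)) : is_subspace U ->
  (forall k, Lg k `<=` U) -> L `<=` U.
Proof.
move=> sU LU x /(dhat_pm_decomp p_neq0)[t [f [Lf ->]]].
apply: subspaceD => //; last exact/(LU 0)/central_deg.
by apply: subspace_sum => // i _; apply: (LU i).
Qed.

Lemma dhat_pm_bracket_deg j k x y : Lg j x -> Lg k y -> Lg (j + k) (dhat_bracket x y).
Proof. exact: dhat_bracket_deg. Qed.

Lemma act_eltP k a u w y : parity (sign_of k) u -> parity (sign_of k) w ->
  act (elt k (a *: u + w)) y = a *: act (elt k u) y + act (elt k w) y.
Proof. by move=> uk wk; rewrite eltP (gmod_linearl gm) //; exact: elt_L. Qed.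

Lemma act_elt_sum k (I : Type) (s : seq I) (t : I -> K) (f : I -> {poly K}) y :
  (forall i, parity (sign_of k) (f i)) ->
  parity (sign_of k) (\sum_(i <- s) t i *: f i) /\
  act (elt k (\sum_(i <- s) t i *: f i)) y = \sum_(i <- s) t i *: act (elt k (f i)) y.
Proof.
move=> fk; elim: s => [|i s [IHp IHa]].
  by rewrite !big_nil elt0 (act0l gm) //; split=> //; exact: parity0.
by rewrite !big_cons act_eltP // IHa; split=> //; exact: parityP.
Qed.

Lemma sign_of_pm1 k : sign_of k = 1 \/ sign_of k = -1.
Proof.
have /eqP := sqr_sign_of p sgn k; rewrite -expr2 sqrf_eq1.
by case/orP=> /eqP; [left | right].
Qed.

Lemma act_bracket_weight (k : nat) u w :
  parity (sign_of k) u -> parity (sign_of (- k%:Z)) w ->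
  act (dhat_bracket (elt k u) (elt (- k%:Z) w)) v =
  lam (dhat_bracket (elt k u) (elt (- k%:Z) w)) *: v.
Proof.
move=> uk wk; apply: v_weight; rewrite -[0](subrr k%:Z).
by apply: dhat_pm_bracket_deg; apply: elt_deg0.
Qed.

Lemma label_series_form_of_finite_dim : finite_dim (Vg (-1)) ->
  exists phi : nat -> K, [/\ quasipolynomial phi, fps_even phi, phi 0 = 0
    & Delta = fps_diffop p (c / 2) (fps_div phi (fps_2sinh_half K))].
Proof.
move=> [n [e eP]]; have [q0 q0p dep] := parity_linear_dependence (sign_of_pm1 (-1)).
have XqP i : parity (sign_of (-1)) ('X^2 ^+ i * q0).
  rewrite -[sign_of _]mul1r; apply: parityM => //.
  by rewrite /parity !rmorphXn /= reflectX sqrrN scale1r.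
have /choice[A AP] : forall i : nat, exists a : 'I_n -> K,
    act (elt (-1) ('X^2 ^+ i * q0)) v = \sum_(j < n) a j *: e j.
  move=> i; apply: eP; rewrite -[-1]addr0; apply: (gmod_degree gm) => //.
  exact: elt_deg0.
have [t [s0 tA]] := dep n A.
have [h [h0 hp hv]] : exists h : {poly K},
    [/\ h != 0, parity (sign_of (-1)) h & act (elt (-1) h) v = 0].
  have [hp ha] := @act_elt_sum (-1) _ (index_enum 'I_n.+1) t _ v (fun i => XqP i).
  eexists; split; [exact: s0 | exact: hp |].
  rewrite ha; under eq_bigr => i _ do rewrite AP scaler_sumr.
  rewrite exchange_big big1 //= => j _.
  by under eq_bigr do rewrite scalerA; rewrite -scaler_suml tA scale0r.
(* An even multiple of the cocycle polynomial: it makes the cocycle vanish and leaves parities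
   unchanged. *)
pose ka : {poly K} := cocycle_poly c 1 * reflect_poly (cocycle_poly c 1).
have ka0 : ka != 0 by rewrite mulf_neq0 ?reflect_eq0 ?cocycle_poly_neq0.
have ka1 : parity 1 ka by exact: even_mul_reflect.
(* One factor [h] is the element killing [v]; the other gives the degree 1 element its parity, which
   is the same as in degree -1. *)
apply: (label_series_form_of_vanishing p_neq0 p_sym (h := h * h * ka)).
- move=> q; rewrite (label_series_reflect p c sgn lam q).
  by rewrite /sign_of expr0z mulr1.
- by rewrite mulf_neq0 // mulf_neq0.
- by have := parityM (parityM hp hp) ka1; rewrite sqr_sign_of mulr1.
move=> e' e'1; have up : parity (sign_of 1) (h * (ka * e')).
  by have := parityM hp (parityM ka1 e'1); rewrite sign_ofN !mulr1.
have kdvd : cocycle_poly c 1 %| h * (ka * e') * h.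
  by rewrite dvdp_mulr // dvdp_mull // dvdp_mulr // dvdp_mulr.
have := lam_bracket_elt p_neq0 p_sym lam_linear (k := 1) up hp kdvd.
(* Both orders of the two operators kill [v], on which their bracket acts by this scalar. *)
have -> : lam (dhat_bracket (elt 1 (h * (ka * e'))) (elt (- 1%:Z) h)) = 0.
  apply/eqP; rewrite -[_ == 0]orbF -(negPf v_neq0) -scaler_eq0.
  rewrite -act_bracket_weight // (gmod_bracket gm); try exact: elt_L.
  rewrite hv (act0r gm); last exact: elt_L.
  rewrite (v_sing (j := 1)) ?(act0r gm) ?subrr //; [exact: elt_L | exact: elt_deg0].
have s0E : sign_of 0 = - (-1) ^+ deg p by rewrite /sign_of expr0z mulr1.
have NN : (-1) ^+ deg p * (-1) ^+ deg p = 1 :> K.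
  by rewrite -exprMn mulrNN mulr1 expr1n.
move=> /eqP; rewrite eq_sym oppr_eq0 linearB linearZ /= (label_series_reflect p c sgn).
rewrite s0E => /eqP D0; set D := pairing Delta _ in D0.
(* By the parity of the label series the two terms are equal, so [D0] says that twice [D] is 0. *)
have {}D0 : D = 0.
  have /eqP : D *+ 2 = 0 by rewrite -[RHS]D0 mulNr mulrN opprK mulrA NN mul1r.
  by rewrite mulrn_eq0 => /eqP.
rewrite -[RHS]D0 /D.
congr (pairing _ (shift _ _ * _)); first by rewrite mul1r.
ring.
Qed.

Hypothesis irr : graded_irreducible L act Vg.
Hypothesis v_gen : forall W : set V, is_submodule L act W -> W v -> W = setT.

(** * Vectors forced to vanish by irreducibility *)

Section Vanishing.
Variable g : nat -> {poly K}.
Hypothesis g_neq0 : forall i, g i != 0.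
Hypothesis g_vanish : forall (i : nat) u w, parity (sign_of i) u ->
  parity (sign_of (- i%:Z)) w -> g i %| w ->
  lam (dhat_bracket (elt i u) (elt (- i%:Z) w)) = 0.

(* Bracketing with degree j turns w into combinations of its shifts by j/2 and
   -j/2; the condition at level k is stable under the shifts that lead to a
   level i <= k. *)
Definition null_poly (k : nat) w := parity (sign_of (- k%:Z)) w /\
  forall (i : nat) (s : int), (0 < i)%N -> (i + `|s| <= k)%N ->
    g i %| shift (s%:~R / 2) w.

Definition null_vectors (m : int) : set V := [set y | exists (k : nat) w,
  [/\ (0 < k)%N, m = - k%:Z, null_poly k w & y = act (elt m w) v]].

(** A shift by j/2 in either direction adds at most j to |s|, exactly what lowering the level from k
    to k - j leaves free. *)
Lemma null_poly_brp (j k : nat) u w : (j < k)%N -> parity (sign_of j) u ->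
  null_poly k w -> null_poly (k - j) (brp p c j (- k%:Z) u w).
Proof.
move=> jk uj [wk gw]; have jkE : j%:Z + - k%:Z = - (k - j)%N%:Z by lia.
split=> [|i s i0 isk]; first by rewrite -jkE; exact: parity_brp.
rewrite /brp rmorphB !rmorphM /=; apply: dvdp_sub.
  apply: dvdp_mull; rewrite shift_shift.
  have -> : s%:~R / 2 + - (j%:~R / 2) = (s - j%:Z)%:~R / 2 :> K.
    by rewrite rmorphB /=; field.
  by apply: gw => //; lia.
apply/dvdp_mulr/dvdp_mulr; rewrite shift_shift.
have -> : s%:~R / 2 + j%:~R / 2 = (s + j%:Z)%:~R / 2 :> K.
  by rewrite rmorphD /=; field.
by apply: gw => //; lia.
Qed.

(** Commuting [x] inwards leaves x v, a multiple of [v], and a bracket. The bracket is again null in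
    negative degree, kills [v] by [g_vanish] in degree 0, and kills it as a highest weight vector in
    positive degree. *)
Lemma null_vectors_nonneg j m x y : (0 <= j)%R -> Lg j x -> null_vectors m y ->
  neg_gen Lg act null_vectors (j + m) (act x y).
Proof.
move=> j0 Lx [k [w [k0 -> [wk gw] ->]]].
have Lw := elt_L wk; have Lxw := Lg_sub Lx.
have -> : act x (act (elt (- k%:Z) w) v) =
    act (dhat_bracket x (elt (- k%:Z) w)) v + act (elt (- k%:Z) w) (act x v).
  by rewrite (gmod_bracket gm) // subrK.
have [jneg|jpos] := leP j 0.
  have jE : j = 0 by lia.
  subst j; rewrite (v_weight Lx) (actZr gm) // add0r addrC; apply: NegGenP.
    by apply: NegGenBase; exists k, w.
  have [u [z [u0 _ xE]]] := dhat_pm_degE p_neq0 Lx.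
  apply: NegGenBase; exists k, (brp p c 0 (- k%:Z) u w); split=> //.
    by rewrite -[k in null_poly k]subn0; apply: (null_poly_brp (j := 0)).
  have := dhat_bracket_elt p c 0 (- k%:Z) u w z 0.
  rewrite {2}/central addr0 -xE => ->; rewrite cocycle_elt_eq0 ?add0r; last lia.
  by rewrite /central addr0.
rewrite (v_sing jpos Lx) (act0r gm) // addr0.
have [n jE] : exists n : nat, j = n%:Z by exists `|j|%N; lia.
subst j; have [u [z [un z0 xE]]] := dhat_pm_degE p_neq0 Lx.
have {z z0}xE : x = elt n u by rewrite xE z0 ?addr0 //; lia.
have [nk|kn|nk] := ltngtP n k.
- have nkE : n%:Z + - k%:Z = - (k - n)%N%:Z by lia.
  apply: NegGenBase; exists (k - n)%N, (brp p c n (- k%:Z) u w); split=> //.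
  + by rewrite subn_gt0.
  + exact: null_poly_brp.
  have := dhat_bracket_elt p c n (- k%:Z) u w 0 0.
  rewrite /central !addr0 cocycle_elt_eq0; last lia.
  by rewrite addr0 -xE nkE => ->.
- rewrite (v_sing (j := n%:Z + - k%:Z)); [exact: NegGen0 | lia |].
  by apply: dhat_pm_bracket_deg => //; exact: elt_deg0.
- rewrite xE; subst k; rewrite act_bracket_weight // g_vanish //.
    by rewrite scale0r; exact: NegGen0.
  by have := gw n 0 k0; rewrite mul0r shift0 addn0; apply.
Qed.

(** The null vectors generate a graded submodule living in degrees at most -1; it misses [v], so
    irreducibility makes it zero. *)
Lemma act_null_poly (k : nat) w : (0 < k)%N -> null_poly k w ->
  act (elt (- k%:Z) w) v = 0.
Proof.
move=> k0 kw; pose W := sum_of_components (neg_gen Lg act null_vectors).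
have BV m : null_vectors m `<=` Vg m.
  move=> y [i [u [i0 mE [ui _] ->]]]; rewrite -mE in ui.
  by have := gmod_degree gm (elt_deg0 c p_neq0 ui) v_deg; rewrite addr0.
have sN m := neg_gen_subspace Lg act null_vectors m.
have Wsub : is_submodule L act W.
  apply: (neg_gen_submodule gm L_subspace Lg_sub dhat_pm_bracket_deg dhat_pm_span).
  exact: null_vectors_nonneg.
have Wgr : is_graded_subset Vg W := neg_gen_graded gm BV.
have Wy : W (act (elt (- k%:Z) w) v).
  apply: (@sub_sum_of_components _ _ _ (- k%:Z)) => //.
  by apply: NegGenBase; exists k, w.
case: (irr.2 W Wsub Wgr) => [W0|WT]; first by move: Wy; rewrite W0.
have Wv : W v by rewrite WT.
have N0v := component_mem (gmod_grading gm) sN (neg_gen_sub gm BV) Wv v_deg.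
have : (0 <= -1 :> int)%R; last by [].
apply: (neg_gen_degree gm Lg_sub _ N0v v_neq0) => m y [i [u [i0 -> _ _]]].
lia.
Qed.

(** A common multiple of all divisors in the level k condition; the shift index is offset by k, so
    that it runs from -k to k. *)
Definition null_modulus (k : nat) : {poly K} :=
  \prod_(i < k.+1) \prod_(s < (2 * k).+1) shift (- ((s%:Z - k%:Z)%:~R / 2)) (g i).

Lemma null_modulus_neq0 n : null_modulus n != 0.
Proof.
by apply/prodf_neq0 => i _; apply/prodf_neq0 => s _; rewrite shift_eq0.
Qed.

Lemma null_poly_of_dvd (k : nat) w : parity (sign_of (- k%:Z)) w ->
  null_modulus k %| w -> null_poly k w.
Proof.
move=> wk kw; split=> // i s i0 isk.
have ik : (i < k.+1)%N by lia.
have sk : (`|(s + k%:Z)%R| < (2 * k).+1)%N by lia.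
rewrite -[g i](shiftK (- (s%:~R / 2))) opprK dvdp_shift //.
apply: dvdp_trans kw; rewrite /null_modulus (bigD1 (Ordinal ik)) //=.
rewrite (bigD1 (Ordinal sk)) //= -mulrA.
have -> : `|(s + k%:Z)%R|%N%:Z - k%:Z = s by lia.
exact: dvdp_mulIl.
Qed.

(** Induction on words: passing an operator of degree -k through one of degree -i costs a bracket of
    degree -(k + i), so the claim is carried for all k at once. *)
Lemma cyclic_annihilator n y : neg_gen Lg act (at_degree0 v) n y ->
  forall k : nat, (0 < k)%N -> exists2 b : {poly K}, b != 0 &
    forall u, parity (sign_of (- k%:Z)) u -> b %| u -> act (elt (- k%:Z) u) y = 0.
Proof.
elim=> {n y} [n y [_ ->]|n|n a y z _ IHy _ IHz|j n x y j0 Lx _ IHy] k k0.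
- exists (null_modulus k); first exact: null_modulus_neq0.
  by move=> u uk ku; apply: act_null_poly => //; apply: null_poly_of_dvd.
- exists 1; rewrite ?oner_eq0 // => u uk _.
  by rewrite (act0r gm) //; exact: elt_L.
- have [b b0 bP] := IHy k k0; have [d d0 dP] := IHz k k0.
  exists (b * d); first by rewrite mulf_neq0.
  move=> u uk bdu; have Lu := elt_L uk.
  have bu : b %| u := dvdp_trans (dvdp_mulIl _ _) bdu.
  have du : d %| u := dvdp_trans (dvdp_mulIr _ _) bdu.
  by rewrite (actP gm) // bP // dP // scaler0 addr0.
have [i jE] : exists i : nat, j = - i%:Z by exists `|j|%N; lia.
subst j; have [w [z [wi z0 xE]]] := dhat_pm_degE p_neq0 Lx.
have {z z0}xE : x = elt (- i%:Z) w by rewrite xE z0 ?addr0 //; lia.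
have [b b0 bP] := IHy k k0; have [|d d0 dP] := IHy (k + i)%N; first lia.
(* [b] kills the commuted term; the two shifts of [d] make both products in the bracket multiples of
   [d]. *)
exists (b * (shift (i%:R / 2) d * shift (- (i%:R / 2)) d)).
  by rewrite !mulf_neq0 ?shift_eq0.
move=> u uk bdu; have Lu := elt_L uk; have Lx' := Lg_sub Lx.
have bu : b %| u := dvdp_trans (dvdp_mulIl _ _) bdu.
have d1u : shift (i%:R / 2) d %| u.
  by apply: dvdp_trans bdu; rewrite dvdp_mull // dvdp_mulIl.
have d2u : shift (- (i%:R / 2)) d %| u.
  by apply: dvdp_trans bdu; rewrite dvdp_mull // dvdp_mulIr.
have -> : act (elt (- k%:Z) u) (act x y) =
    act (dhat_bracket (elt (- k%:Z) u) x) y + act x (act (elt (- k%:Z) u) y).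
  by rewrite (gmod_bracket gm) // subrK.
rewrite bP // (act0r gm) // addr0 xE.
have := dhat_bracket_elt p c (- k%:Z) (- i%:Z) u w 0 0.
rewrite /central !addr0 cocycle_elt_eq0; last lia.
rewrite addr0 => ->; have kiE : - k%:Z + - i%:Z = - (k + i)%N%:Z by lia.
have := parity_brp p_sym uk wi; rewrite kiE => Bki; apply: dP => //.
have iE : (- i%:Z)%:~R / 2 = - (i%:R / 2) :> K by rewrite rmorphN /=; field.
rewrite /brp iE opprK; apply: dvdp_sub.
  apply/dvdp_mulr/dvdp_mulr; rewrite -[d](shiftK (i%:R / 2)).
  exact: dvdp_shift.
apply: dvdp_mull; rewrite -[d](shiftK (- (i%:R / 2))) opprK.
exact: dvdp_shift.
Qed.

(** Negative operators generate the module from [v], and on each vector those of degree -k act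
    through polynomials of one parity modulo a nonzero [b]. *)
Lemma finite_dim_of_vanishing : quasifinite Vg.
Proof.
move=> n; apply: finite_dim_of_fin_spanned.
have BV m : at_degree0 v m `<=` Vg m by move=> y [-> ->].
have sN m := neg_gen_subspace Lg act (at_degree0 v) m.
have Nsub : is_submodule L act (sum_of_components (neg_gen Lg act (at_degree0 v))).
  apply: (neg_gen_submodule gm L_subspace Lg_sub dhat_pm_bracket_deg dhat_pm_span).
  move=> j m x y; rewrite le_eqVlt => /orP[/eqP <- Lx [-> ->]|j0 Lx [_ ->]].
    rewrite v_weight // add0r -[_ *: _]addr0; apply: NegGenP; last exact: NegGen0.
    by apply: NegGenBase.
  by rewrite (v_sing j0 Lx); exact: NegGen0.
have NT : sum_of_components (neg_gen Lg act (at_degree0 v)) = setT.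
  apply: v_gen => //; apply: (@sub_sum_of_components _ _ _ 0) => //.
  exact: NegGenBase.
have -> : Vg n = neg_gen Lg act (at_degree0 v) n.
  apply/seteqP; split; last exact: (neg_gen_sub gm BV).
  move=> y Vy; apply: (component_mem (gmod_grading gm) sN (neg_gen_sub gm BV)) => //.
  by rewrite NT.
apply: (fin_spanned_cyclic gm Lg_sub) => m y m0 [j Ny].
have [k mE] : exists k : nat, m = - k%:Z by exists `|m|%N; lia.
have k0 : (0 < k)%N by lia.
subst m; have [b b0 bP] := cyclic_annihilator Ny k0.
have [N UN] := parity_span_mod (sqr_sign_of p sgn (- k%:Z)) b0.
pose f i := elt (- k%:Z) (parity_part (sign_of (- k%:Z)) 'X^i).
have fk i : parity (sign_of (- k%:Z)) (parity_part (sign_of (- k%:Z)) 'X^i).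
  exact/parity_parity_part/sqr_sign_of.
exists [seq f i | i <- iota 0 N]; split=> [x /mapP[i _ ->]|U sU Uf x Lx].
  exact: elt_deg0.
have [u [z [uk z0 ->]]] := dhat_pm_degE p_neq0 Lx.
have [U0 UP] := sU.
rewrite z0 ?addr0; last lia.
apply: (UN [set u | parity (sign_of (- k%:Z)) u /\ U (act (elt (- k%:Z) u) y)] _ _ _ u uk).2.
- split=> [|a q r [qk Uq] [rk Ur]].
    by rewrite /= elt0 (act0l gm) //; split=> //; exact: parity0.
  by split; [exact: parityP | rewrite act_eltP //; exact: UP].
- by move=> q qk bq; split=> //; rewrite bP.
- by move=> i iN; split=> //; apply/Uf/map_f; rewrite mem_iota.
Qed.

End Vanishing.

Lemma quasifinite_of_label_series_form phi : quasipolynomial phi ->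
  Delta = fps_diffop p (c / 2) (fps_div phi (fps_2sinh_half K)) -> quasifinite Vg.
Proof.
move=> phi_qp DeltaE.
have /choice[g gP] : forall i : nat, exists g : {poly K}, g != 0 /\
    forall u w, parity (sign_of i) u -> parity (sign_of (- i%:Z)) w -> g %| w ->
    lam (dhat_bracket (elt i u) (elt (- i%:Z) w)) = 0.
  move=> i; have [r r0 rP] := vanishing_of_label_series_form p_sym i phi_qp DeltaE.
  (* [r] makes the pairing with the label series vanish, and the second factor removes the
     cocycle. *)
  exists (r * cocycle_poly c i); split=> [|u w ui wi rw].
    by rewrite mulf_neq0 ?cocycle_poly_neq0.
  rewrite (lam_bracket_elt p_neq0 p_sym lam_linear ui wi); last first.
    exact/dvdp_mull/(dvdp_trans (dvdp_mulIr _ _) rw).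
  rewrite rP ?oppr0 //; last exact/dvdp_mull/(dvdp_trans (dvdp_mulIl _ _) rw).
  by have := parityM ui wi; rewrite sign_ofN sqr_sign_of.
apply: (finite_dim_of_vanishing (g := g)) => i; first exact: (gP i).1.
exact: (gP i).2.
Qed.

End HighestWeightModule.

Local Open Scope complex_scope.

Theorem theorem3p8 (R : realType) (p : {poly R[i]}) (c : R[i])
    (p_neq0 : p != 0)
    (p_sym : p = (-1) ^+ deg p *: (p \Po (- 'X + c%:P)))
    (sgn : bool)
    (lam : dhat R[i] -> R[i])
    (lam_linear : linear_on (dhat_pm_deg sgn p c 0) lam)
    (V : lmodType R[i]) (act : dhat R[i] -> V -> V) (Vg : int -> set V)
    (V_irr : is_irr_highest_weight_module (@dhat_bracket R[i])
               (dhat_pm sgn p c) (dhat_pm_deg sgn p c) act Vg lam) :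
  quasifinite Vg <->
  exists phi : nat -> R[i],
    [/\ quasipolynomial phi, fps_even phi, phi 0%N = 0
      & label_series p c lam =
        fps_diffop p (c / 2%:R) (fps_div phi (fps_2sinh_half R[i]))].
Proof.
case: V_irr => gm irr [v [v_neq0 v_deg v_weight v_sing v_gen]].
split=> [qf|[phi [phi_qp _ _ DeltaE]]].
  exact: (label_series_form_of_finite_dim p_neq0 p_sym lam_linear gm v_neq0
            v_deg v_weight v_sing (qf (-1))).
exact: (quasifinite_of_label_series_form p_neq0 p_sym lam_linear gm v_neq0
          v_deg v_weight v_sing irr v_gen phi_qp DeltaE).
Qed.
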